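(* Let Assumption (A) (see context) hold. For $i=0,1$ let $(u^i,V^i)$ be a solution of $$du=dV-A(u)\,dt$$ (in the sense of the context) on a probability space $(\Omega^i,\mathcal F^i,\mathbb P^i)$. If $\mathcal L(V^0)=\mathcal L(V^1)$, then $\mathcal L(u^0,V^0)=\mathcal L(u^1,V^1)$.
   Context: $U$ is a separable Banach space, $H$ a Hilbert space identified with its dual, the embeddings $U\hookrightarrow H\hookrightarrow U'$ are dense, $(f,v)=f(v)$ denotes the pairing of $U'$ with $U$ (equal to $(f,v)_H$ if $f\in H$), $A:U\to U'$, $T>0$, $1<r<\infty$, and $$\mathbb X_1=C[0,T;U']\cap L^r[0,T;U]_{weak},$$ where $L^r[0,T;U]_{weak}$ is the Bochner space with its weak topology and the intersection carries the coarsest topology making both inclusions continuous. $\mathcal L(X)$ denotes the law of a random variable $X$ on the Borel $\sigma$-algebra of its target space. Assumption (A): if $\lambda>0$ and $u_1,u_2\in C[0,T;U']\cap L^r[0,T;U]$ satisfy $A(u_1),A(u_2)\in L^1[0,T;U']$ and $$(u_2(t)-u_1(t),v)+\int_0^t\lambda\,(A(u_2(s))-A(u_1(s)),v)\,ds=0,\qquad t\in[0,T],\ v\in U,$$ then $u_1=u_2$. (If this holds for some $T>0$ then it holds for all $T>0$.) Solution: a pair $(u,V)$ of random variables on a probability space $(\Omega,\mathcal F,\mathbb P)$ with values in $\mathbb X_1\times C[0,T;U']$ is a solution of $du=dV-A(u)\,dt$ if $\mathbb P[u\in S]=1$ for some $\sigma$-compact set $S$ in $\mathbb X_1$, $A(u)\in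 L^1[0,T;U']$ almost surely, and $$\mathbb P\Big[(u(t),v)=(V(t),v)-\int_0^t(A(u(s)),v)\,ds\Big]=1,\qquad t\in[0,T],\ v\in U.$$
   Formalization: The formal theorem additionally assumes that A : U → U' is Borel measurable; for a completely arbitrary map A the claim fails, e.g. A(a,c) = (0, −f(a)) on R² with f a non-measurable function whose graph has full outer measure for two product measures. *)

(* Defs.v *)
From HB Require Import structures.
From mathcomp Require Import all_boot all_order all_algebra.
From mathcomp Require Import sesquilinear.
From mathcomp Require Import all_classical all_reals all_analysis measurable_realfun.
Import Order.TTheory GRing.Theory Num.Theory.
Import numFieldNormedType.Exports.
Set Implicit Arguments.
Unset Strict Implicit.
Unset Printing Implicit Defensive.
Local Open Scope classical_set_scope.
Local Open Scope ring_scope.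

Section Dual.
Context {R : realType} (U : normedModType R).

Definition dual_pred : {pred U -> R^o} :=
  mem [set f : U -> R^o | linear f /\ continuous f].

Lemma dual_submod_closed : submod_closed dual_pred.
Proof.
split; first by rewrite inE; split=> [a u v|x]; [rewrite scaler0 addr0|exact: cst_continuous].
move=> a f g; rewrite !inE /= => -[lf cf] [lg cg]; split.
  move=> b u v.
  change (a *: f (b *: u + v) + g (b *: u + v) =
    b *: (a *: f u + g u) + (a *: f v + g v)).
  by rewrite lf lg !scalerDr !scalerA mulrC addrACA.
by move=> x; apply: cvgD; [apply: cvgZl_tmp; exact: cf|exact: cg].
Qed.

HB.instance Definition _ := GRing.isSubmodClosed.Build R _ dual_pred
  dual_submod_closed.

Record dual := Dual { dual_fun :> U -> R^o; dual_funP : dual_fun \in dual_pred }.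

HB.instance Definition _ := [isSub for dual_fun].
HB.instance Definition _ := [Choice of dual by <:].
HB.instance Definition _ := [SubChoice_isSubLmodule of dual by <:].

Lemma dual_linear (f : dual) : linear f.
Proof. by have := dual_funP f; rewrite inE => -[]. Qed.

Lemma dual_continuous (f : dual) : continuous f.
Proof. by have := dual_funP f; rewrite inE => -[]. Qed.

HB.instance Definition _ (f : dual) :=
  GRing.isLinear.Build R U R^o *:%R f (dual_linear f).

Definition dual_norm (f : dual) : R :=
  sup [set `|f x| | x in [set x | `|x| <= 1]].

Lemma dual_norm_has_sup (f : dual) :
  has_sup [set `|f x| | x in [set x | `|x| <= 1]].
Proof.
split; first by exists `|f 0|; exists 0 => //=; rewrite normr0.
have /(@bounded_funP R U R^o f)/(_ 1)[M fM] :
    bounded_near (f : U -> R^o) (nbhs (0 : U)).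
  by apply/(@linear_bounded_continuous R U R^o f); exact: dual_continuous.
by exists M => _ [x /= x1 <-]; exact: fM.
Qed.

Lemma dual_norm_ub (f : dual) x : `|x| <= 1 -> `|f x| <= dual_norm f.
Proof.
move=> x1; apply: sup_upper_bound; first exact: dual_norm_has_sup.
by exists x.
Qed.

Lemma dual_norm_le (f : dual) (M : R) :
  (forall x, `|x| <= 1 -> `|f x| <= M) -> dual_norm f <= M.
Proof.
move=> fM; apply: ge_sup; first by case: (dual_norm_has_sup f).
by move=> _ [x /= x1 <-]; exact: fM.
Qed.

Lemma dual_normD (f g : dual) : dual_norm (f + g) <= dual_norm f + dual_norm g.
Proof.
apply: dual_norm_le => x x1; apply: (le_trans (ler_normD _ _)).
by apply: lerD; exact: dual_norm_ub.
Qed.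

Lemma dual_normZ_le (a : R) (f : dual) : dual_norm (a *: f) <= `|a| * dual_norm f.
Proof.
apply: dual_norm_le => x x1; rewrite normrM ler_wpM2l//.
exact: dual_norm_ub.
Qed.

Lemma dual_normZ (a : R) (f : dual) : dual_norm (a *: f) = `|a| * dual_norm f.
Proof.
apply/eqP; rewrite eq_le dual_normZ_le/=.
have [->|a0] := eqVneq a 0.
  rewrite normr0 mul0r scale0r; apply: le_trans (dual_norm_ub 0 (x := 0) _) => //.
  by rewrite normr0.
rewrite -ler_pdivlMl ?normr_gt0// -normfV.
by apply: le_trans (dual_normZ_le _ _); rewrite scalerA mulVf// scale1r.
Qed.

Lemma dual_norm0_eq0 (f : dual) : dual_norm f = 0 -> f = 0.
Proof.
move=> f0; apply/val_inj/funext => x /=.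
have [->|x0] := eqVneq x 0; first by rewrite linear0.
have nx0 : 0 < `|x| by rewrite normr_gt0.
have : `|f (`|x|^-1 *: x)| <= 0.
  rewrite -f0; apply: dual_norm_ub.
  by rewrite normrZ normfV normr_id mulVf// gt_eqF.
rewrite normr_le0 linearZ/= scaler_eq0 invr_eq0 gt_eqF//= => /eqP ->.
by [].
Qed.

HB.instance Definition _ := Lmodule_isNormed.Build R dual
  dual_normD dual_normZ dual_norm0_eq0.

End Dual.

Section Bochner.
Context {R : realType}.
Local Notation mu := (@lebesgue_measure R).

Definition simple_map (X : Type) (s : R -> X) : Prop :=
  finite_set (range s) /\ forall x, measurable (s @^-1` [set x]).

(* On a separable X this is Borel measurability. Every a.e.-class of mu-strongly
   measurable functions (a.e. limits) has such a representative. *)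
Definition strongly_measurable (X : normedModType R) (D : set R) (f : R -> X) :=
  exists s : nat -> R -> X,
    (forall n, simple_map (s n)) /\
    forall t, D t -> s n t @[n --> \oo] --> f t.

Definition in_Lp (X : normedModType R) (T p : R) (f : R -> X) : Prop :=
  strongly_measurable `[0, T] f /\
  (\int[mu]_(t in `[0%R, T]) (`|f t| `^ p)%:E < +oo)%E.

Lemma simple_map2 (X Y Z : Type) (h : X -> Y -> Z) s1 s2 :
  simple_map s1 -> simple_map s2 -> simple_map (fun t => h (s1 t) (s2 t)).
Proof.
move=> [f1 m1] [f2 m2]; split.
  have := finite_image (fun xy => h xy.1 xy.2) (finite_setX f1 f2).
  apply: sub_finite_set => _ [t _ <-].
  by exists (s1 t, s2 t) => //; split; exists t.
move=> z.
rewrite (_ : _ @^-1` _ = \bigcup_(x in range s1) \bigcup_(y in [set y | range s2 y /\ h x y = z])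
  (s1 @^-1` [set x] `&` s2 @^-1` [set y])).
  apply: fin_bigcup_measurable => // x _.
  apply: fin_bigcup_measurable; first by apply: sub_finite_set f2 => y [].
  by move=> y _; exact: measurableI.
apply/seteqP; split=> [t /= tz|t [x _ [y [_ yz] [/= -> ->]]]]//.
by exists (s1 t); [exists t|exists (s2 t) => //; split => //; exists t].
Qed.

Section Lp.
Variables (X : normedModType R) (T p : R) (p1 : 1 <= p).

Lemma strongly_measurable_norm (f : R -> X) :
  strongly_measurable `[0, T] f -> measurable_fun `[0, T] (fun t => `|f t|).
Proof.
move=> [s [ss sf]].
apply: (measurable_fun_cvg (h := fun n t => `|s n t|)).
- move=> n; apply: (@measurable_funTS _ _ _ _ _).
  have [fs ms] := ss n.
  move=> _ B _; rewrite setTI.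
  rewrite (_ : _ @^-1` _ = \bigcup_(x in [set x | range (s n) x /\ B `|x|]) (s n @^-1` [set x])).
    apply: fin_bigcup_measurable; first by apply: sub_finite_set fs => y [].
    by move=> x _; exact: ms.
  apply/seteqP; split=> [t /= tB|t [x [_ Bx] /= ->]]//.
  by exists (s n t) => //; split=> //; exists t.
- by move=> t tT; apply: cvg_norm; exact: sf.
Qed.

Definition Lp_pred of 1 <= p : {pred R -> X} := mem [set f | in_Lp T p f].

Lemma Lp_submod_closed : submod_closed (Lp_pred p1).
Proof.
have p0 : 0 < p by exact: lt_le_trans p1.
split.
  rewrite inE; split.
    exists (fun=> 0); split=> [n|t _]; last exact: cvg_cst.
    split; first by apply: sub_finite_set (finite_set1 0) => _ [t _ <-].
    move=> x; rewrite preimage_cst; case: ifP => _ //.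
  rewrite integral0_eq ?ltry// => t _.
  by rewrite normr0 powR0// gt_eqF.
move=> a f g; rewrite !inE => -[sf intf] [sg intg].
have sfg : strongly_measurable `[0, T] (a *: f + g).
  move: sf sg => [s [ss sf]] [s' [ss' sg]].
  exists (fun n t => a *: s n t + s' n t); split=> [n|t tT].
    exact: (simple_map2 (fun x y => a *: x + y)).
  by apply: cvgD; [apply: cvgZl_tmp; exact: sf|exact: sg].
split=> //.
pose k := (2 * (`|a| + 1)) `^ p.
have mpow (h : R -> X) : strongly_measurable `[0, T] h ->
    measurable_fun `[0, T] (fun t => (`|h t| `^ p)%:E).
  move=> sh; apply/measurable_EFinP.
  apply: (@measurableT_comp _ _ _ _ _ _ (@powR R ^~ p)) => //.
  exact: strongly_measurable_norm.
apply: (@le_lt_trans _ _ (\int[mu]_(t in `[0%R, T])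
    (k%:E * ((`|f t| `^ p)%:E + (`|g t| `^ p)%:E)))%E).
  apply: ge0_le_integral => //.
  - exact: mpow.
  - by apply: emeasurable_funM => //; apply: emeasurable_funD; exact: mpow.
  move=> t _; rewrite -EFinD -EFinM lee_fin.
  pose m := Num.max `|f t| `|g t|.
  have m0 : 0 <= m by rewrite le_max normr_ge0.
  apply: (@le_trans _ _ (k * m `^ p)).
    rewrite -powRM ?mulr_ge0 ?addr_ge0//.
    apply: ge0_ler_powR; rewrite ?nnegrE ?mulr_ge0 ?addr_ge0 ?(ltW p0)//.
    change (`|a *: f t + g t| <= 2 * (`|a| + 1) * m).
    apply: le_trans (ler_normD _ _) _; rewrite normrZ.
    apply: (@le_trans _ _ (`|a| * m + m)).
      by rewrite lerD ?ler_wpM2l// le_max lexx ?orbT.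
    rewrite -[X in _ + X]mul1r -mulrDl ler_wpM2r//.
    by rewrite ler_peMl ?addr_ge0// ler1n.
  rewrite ler_wpM2l ?powR_ge0// /m /Order.max.
  by case: ifP => _; rewrite ?lerDl ?lerDr powR_ge0.
rewrite ge0_integralZl//=; first last.
- by rewrite lee_fin powR_ge0.
- by move=> t _; rewrite adde_ge0 ?lee_fin ?powR_ge0.
- by apply: emeasurable_funD; exact: mpow.
rewrite lte_mul_pinfty ?lee_fin ?powR_ge0//.
rewrite ge0_integralD//=; first exact: lte_add_pinfty.
- exact: mpow.
- exact: mpow.
Qed.

HB.instance Definition _ := GRing.isSubmodClosed.Build R _ (Lp_pred p1)
  Lp_submod_closed.

(* L^p[0,T;X] before identification of a.e. equal functions. *)
Record Lp := MkLp { Lp_fun :> R -> X; Lp_funP : Lp_fun \in Lp_pred p1 }.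

HB.instance Definition _ := [isSub for Lp_fun].
HB.instance Definition _ := [Choice of Lp by <:].
HB.instance Definition _ := [SubChoice_isSubLmodule of Lp by <:].

Definition Lp_norm (f : Lp) : R :=
  (\int[mu]_(t in `[0, T]) (`|f t| `^ p)) `^ p^-1.

(* Boundedness for the seminorm makes phi insensitive to null sets, so these
   are exactly the elements of the dual of the quotient space. *)
Definition Lp_dual :=
  {phi : {scalar Lp} | exists C : R, forall f, `|phi f| <= C * Lp_norm f}.

Definition weak_Lp : Type := Lp.
HB.instance Definition _ := Topological.copy weak_Lp
  (sup_topology (fun phi : Lp_dual =>
     Topological.class (initial_topology (sval phi : Lp -> R^o)))).

End Lp.
End Bochner.

Section ContinuousPaths.
Context {R : realType}.

Definition time (T : R) : Type := set_type `[0, T].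
HB.instance Definition _ (T : R) := Topological.on (time T).

(* C[0,T;E] with the topology of uniform convergence. *)
Definition CT (T : R) (E : normedModType R) : Type := continuousType (time T) E.

HB.instance Definition _ (T : R) (E : normedModType R) :=
  Uniform.copy (CT T E)
    (initial_topology
       (fun f : continuousType (time T) E => (f : {uniform time T -> E}))).
End ContinuousPaths.

Definition separable (X : topologicalType) : Prop :=
  exists2 D : set X, countable D & dense D.

Definition sigma_compact (X : topologicalType) (S : set X) : Prop :=
  exists K : nat -> set X, (forall n, compact (K n)) /\ S = \bigcup_n K n.

Definition borel (X : topologicalType) : set (set X) := <<s open >>.

(* To be imposed on A : U -> U': for an arbitrary map A uniqueness in law can
   fail. With U = H = R^2 and A(a,c) = (0,-f(a)), where the graph of f has full
   outer measure for two product measures with the same first marginal, put the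
   trace of either measure on the graph and take u(t) = (x, t f(x)),
   V(t) = (x, 0). *)
Definition borel_fun (X Y : topologicalType) (f : X -> Y) : Prop :=
  forall B, borel B -> borel (f @^-1` B).

Section RandomVariables.
Context {R : realType} d (Om : measurableType d) (X : topologicalType).

Definition random_variable (f : Om -> X) : Prop :=
  forall B, borel B -> measurable (f @^-1` B).

Definition law (P : probability Om R) (f : Om -> X) (B : set X) : \bar R :=
  P (f @^-1` B).
End RandomVariables.

Section Triple.
Context {R : realType} {U H : completeNormedModType R}.
Variables (ip : {dot H for idfun}) (iota : {linear U -> H}).

(* h : H, seen as an element of U', is f. *)
Definition represents (h : H) (f : dual U) : Prop :=
  forall v, f v = ip h (iota v).

Record embedding_triple : Prop := {
  ip_norm : forall h, ip h h = `|h| ^+ 2;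
  iota_continuous : continuous iota;
  iota_injective : injective iota;
  iota_dense : dense (range iota);
  H_dense : dense [set f : dual U | exists h, represents h f]
}.

Section X1.
Variables (T r : R) (r1 : 1 < r).

(* u in L^r[0,T;U] and w in C[0,T;U'] coincide as U'-valued functions. *)
Definition Lr_version (w : CT T (dual U)) (u : Lp U T (ltW r1)) : Prop :=
  {ae lebesgue_measure, forall s : R, forall sT : s \in `[0, T]%classic,
     represents (iota (u s)) (w (SigSub sT))}.

(* C[0,T;U'] \cap L^r[0,T;U]. *)
Record X1 := MkX1 {
  X1_C : CT T (dual U);
  X1_Lr_subproof : exists u, Lr_version X1_C u }.

(* A representative of w in L^r; it is unique up to a null set. *)
Definition X1_Lr (w : X1) : weak_Lp U T (ltW r1) := sval (cid (X1_Lr_subproof w)).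

HB.instance Definition _ := gen_eqMixin X1.
HB.instance Definition _ := gen_choiceMixin X1.

(* The coarsest topology making both inclusions continuous. *)
Definition X1_topologies (b : bool) : Topological X1 :=
  if b then Topological.class (initial_topology X1_C)
  else Topological.class (initial_topology X1_Lr).

HB.instance Definition _ := Topological.copy X1 (sup_topology X1_topologies).

Variable A : U -> dual U.

Definition in_L1 (w : X1) : Prop := in_Lp T 1 (fun s => A (X1_Lr w s)).

Definition assumption_A : Prop :=
  forall (lam : R) (u1 u2 : X1), 0 < lam -> in_L1 u1 -> in_L1 u2 ->
    (forall (t : time T) (v : U),
       (X1_C u2 t - X1_C u1 t) v +
       \int[lebesgue_measure]_(s in `[0, \val t])
          (lam * (A (X1_Lr u2 s) - A (X1_Lr u1 s)) v) = 0) ->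
    u1 = u2.

Record solution d (Om : measurableType d) (P : probability Om R)
    (u : Om -> X1) (V : Om -> CT T (dual U)) : Prop := {
  solution_rv : random_variable (fun om => (u om, V om));
  solution_sigma_compact :
    exists2 S : set X1, sigma_compact S & P (u @^-1` S) = 1%E;
  solution_L1 : {ae P, forall om, in_L1 (u om)};
  solution_eq : forall (t : time T) (v : U),
    {ae P, forall om,
       X1_C (u om) t v = V om t v -
         \int[lebesgue_measure]_(s in `[0, \val t]) (A (X1_Lr (u om) s) v)} }.
End X1.
End Triple.

(* Main.v *)
(* Assumption (A) is a pathwise statement, so V determines u and no product of
   conditional laws is needed. With w the path of u in C[0,T;U'], the pairs (w,v)
   solving the equation form a set G on which the projection to v is injective.

   G is Borel: writing J for the embedding of U in U', the image of J is dense and J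
   is symmetric, so by Hahn-Banach |x| <= c iff |<Jx,y>| <= c|Jy| for y in a countable
   dense set; hence J(U) and the inverse of J are Borel. As u(s) is the inverse of J at
   w(s) for almost every s, the drift integrals are Borel in w by Fubini.

   On a compact K in X_1 the topology is that of C[0,T;U'], where finite Borel measures
   are inner regular. So a Borel set B contains, up to a null set for the law of
   (u^0,V^0), a countable union F of closed sets lying in G and over compact sets. The
   projections of these to v are closed, so P^0[(u^0,V^0) in B] <= P^0[V^0 in pr F] =
   P^1[V^1 in pr F] <= P^1[(u^1,V^1) in B], the last step because (u^1,V^1) is in G.
   Equality follows by exchanging the roles of 0 and 1. *)
Require Import Defs.
From HB Require Import structures.
From mathcomp Require Import all_boot all_order all_algebra.
From mathcomp Require Import sesquilinear.
From mathcomp Require Import all_classical all_reals all_analysis measurable_realfun.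
From mathcomp Require Import ring lra.
Import Order.TTheory GRing.Theory Num.Theory.
Import numFieldNormedType.Exports.
Set Implicit Arguments.
Unset Strict Implicit.
Unset Printing Implicit Defensive.
Local Open Scope classical_set_scope.
Local Open Scope ring_scope.

(** * The embedding of U in U' *)

Section HahnBanach.
Context {R : realType} (U : normedModType R).
Implicit Types G : set (U * R).

(** Graphs of partial linear functionals bounded by the norm, as relations. Single-valuedness is not
    imposed: it follows from the bound, as [Gfun] below shows. The empty graph qualifies as well. *)
Let dominated G := (forall a p q, G p -> G q -> G (a *: p.1 + q.1, a * p.2 + q.2))
  /\ (forall p, G p -> p.2 <= `|p.1|).

Let extension G (y : U) (c : R) : set (U * R) :=
  [set p | exists q t, G q /\ p = (q.1 + t *: y, q.2 + t * c)].

(** The one-dimensional step of Hahn-Banach. By the triangle inequality every [p.2 - |p.1 - y|] lies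
    below every [|q.1 + y| - q.2], and the supremum of the former serves as the value at [y]. *)
Lemma dominated_extend G y : dominated G -> G !=set0 ->
  exists c, dominated (extension G y c).
Proof.
move=> [Gl Gn] [p0 Gp0].
have GZ a p : G p -> G (a *: p.1, a * p.2).
  move=> Gp; have := Gl (a - 1) p p Gp Gp.
  by rewrite scalerBl mulrBl scale1r mul1r !subrK.
have sepG p q : G p -> G q -> p.2 - `|p.1 - y| <= `|q.1 + y| - q.2.
  move=> Gp Gq; rewrite lerBlDr addrAC lerBrDr.
  have := Gn _ (Gl 1 _ _ Gp Gq); rewrite /= scale1r mul1r => /le_trans; apply.
  by rewrite -[p.1 + q.1](subrKA y) addrC [y + _]addrC ler_normD.
pose S := [set p.2 - `|p.1 - y| | p in G].
have S0 : S !=set0 by exists (p0.2 - `|p0.1 - y|); exists p0.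
pose c := sup S.
have cl p : G p -> p.2 - `|p.1 - y| <= c.
  move=> Gp; apply: ub_le_sup; last by exists p.
  by exists (`|p0.1 + y| - p0.2) => _ [q Gq <-]; exact: sepG.
have cu q : G q -> c <= `|q.1 + y| - q.2.
  by move=> Gq; apply: ge_sup => // _ [p Gp <-]; exact: sepG.
exists c; split.
  move=> a _ _ [p [t [Gp ->]]] [q [s [Gq ->]]] /=.
  exists (a *: p.1 + q.1, a * p.2 + q.2), (a * t + s); split; first exact: Gl.
  congr (_, _) => /=; last by ring.
  by rewrite scalerDr scalerDl !scalerA addrACA.
move=> _ [p [t [Gp ->]]] /=.
(* Scaling by the inverse of [|t|] reduces a negative [t] to the lower bound [cl] and a positive one
   to the upper bound [cu]. *)
have [t0|t0|->] := ltgtP t 0; last by rewrite scale0r mul0r !addr0 Gn.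
- have nt : 0 < - t by rewrite oppr_gt0.
  have := cl _ (GZ (- t)^-1 _ Gp) => /=; rewrite lerBlDr => h.
  have E : `|p.1 + t *: y| = - t * `|(- t)^-1 *: p.1 - y|.
    rewrite -[in RHS](gtr0_norm nt) -normrZ scalerBr scalerA gtr0_norm// mulfV ?gt_eqF//.
    by rewrite scale1r scaleNr opprK.
  have := ler_wpM2l (ltW nt) h.
  by rewrite E mulrDr mulrA mulfV ?gt_eqF// mul1r mulNr; lra.
- have := cu _ (GZ t^-1 _ Gp) => /=; rewrite lerBrDr => h.
  have E : `|p.1 + t *: y| = t * `|t^-1 *: p.1 + y|.
    rewrite -[in RHS](gtr0_norm t0) -normrZ scalerDr scalerA gtr0_norm// mulfV ?gt_eqF//.
    by rewrite scale1r.
  have := ler_wpM2l (ltW t0) h.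
  by rewrite E mulrDr mulrA mulfV ?gt_eqF// mul1r; lra.
Qed.

(** Zorn's lemma extends the functional [t x -> t |x|] on the line through [x]; a maximal graph is
    total by [dominated_extend]. *)
Lemma norming_functional (x : U) :
  exists2 f : dual U, (forall y, `|f y| <= `|y|) & f x = `|x|.
Proof.
pose base : set (U * R) := [set p | exists t, p = (t *: x, t * `|x|)].
have baseD : dominated base.
  split=> [a _ _ [t ->] [s ->]|_ [t ->]] /=.
    by exists (a * t + s); rewrite scalerDl scalerA mulrDl mulrA.
  by rewrite normrZ ler_wpM2r// ler_norm.
(* The union of the empty chain is empty, so only nonempty graphs are asked to contain [base]. *)
have [G [[Gd Gb] Gmax]] : exists G, (dominated G /\ (G !=set0 -> base `<=` G)) /\
    forall B, G `<` B -> ~ (dominated B /\ (B !=set0 -> base `<=` B)).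
  apply: (@Zorn_bigcup _ (fun G => dominated G /\ (G !=set0 -> base `<=` G))).
  move=> F FP Ftot; split.
    split=> [a p q [A FA Ap] [B FB Bq]|p [A FA Ap]].
      have [AB|BA] := Ftot _ _ FA FB.
        by exists B => //; apply: (FP _ FB).1.1 => //; exact: AB.
      by exists A => //; apply: (FP _ FA).1.1 => //; exact: BA.
    by apply: (FP _ FA).1.2.
  move=> [p [A FA Ap]] q bq; exists A => //.
  by apply: (FP _ FA).2 => //; exists p.
have G0 : G !=set0.
  apply/set0P/eqP => G0; apply: (Gmax base); last by split=> [|_ ?].
  rewrite G0; split=> [//|]; first by move=> /(_ (0, 0)); apply; exists 0; rewrite scale0r mul0r.
have bG := Gb G0.
have G00 : G (0, 0) by apply: bG; exists 0; rewrite scale0r mul0r.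
have Gtot y : exists a, G (y, a).
  apply: contrapT => ny.
  have [c cD] := dominated_extend y Gd G0.
  have Gs : G `<=` extension G y c.
    by move=> p Gp; exists p, 0; split=> //; rewrite scale0r mul0r !addr0; case: p {Gp}.
  apply: (Gmax (extension G y c)).
    split => // /(_ (y, c)) h; apply: ny; exists c; apply: h.
    by exists (0, 0), 1; rewrite /= scale1r mul1r !add0r.
  by split=> // _; exact: subset_trans Gs.
pose f y := sval (cid (Gtot y)).
have Gf y : G (y, f y) by exact: svalP (cid (Gtot y)).
(* The difference [(0, a - b)] lies in [G], so the bound gives [a - b <= 0]. *)
have Gfun y a b : G (y, a) -> G (y, b) -> a <= b.
  move=> Ga Gab; have := Gd.2 _ (Gd.1 (-1) _ _ Gab Ga).
  by rewrite /= scaleN1r addNr normr0 mulN1r addrC subr_le0.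
have Gfe y a : G (y, a) -> f y = a.
  by move=> Ga; apply/eqP; rewrite eq_le !(@Gfun y).
have fl : linear (f : U -> R^o).
  by move=> a y z; apply: Gfe; exact: (Gd.1 a _ _ (Gf y) (Gf z)).
have fn y : `|f y| <= `|y|.
  rewrite ler_norml (Gd.2 _ (Gf y)) andbT lerNl.
  have := Gd.2 _ (Gd.1 (-1) _ _ (Gf y) G00).
  by rewrite /= !addr0 scaleN1r mulN1r normrN.
have fc : continuous (f : U -> R^o).
  pose fL := GRing.isLinear.Build R U R^o *:%R (f : U -> R^o) fl.
  pose F : {linear U -> R^o} := HB.pack (f : U -> R^o) fL.
  apply: (bounded_linear_continuous (f := F)).
  exists 1; split=> // M M1; near=> y.
  apply: le_trans (fn y) _; apply: ltW; apply: lt_trans M1.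
  near: y; apply: (@nbhs0_lt _ _ _ ltr01).
have fP : (f : U -> R^o) \in @dual_pred R U by rewrite inE; split.
by exists (Dual fP) => //; apply: Gfe; apply: bG; exists 1; rewrite scale1r mul1r.
Unshelve. all: by end_near. Qed.

End HahnBanach.

(** * The maps of H and U into U' given by the inner product *)

Section Riesz.
Context {R : realType} {U H : completeNormedModType R}.
Variables (ip : {dot H for idfun}) (iota : {linear U -> H}).
Hypothesis UH : embedding_triple ip iota.

Lemma ipC (a b : H) : ip a b = ip b a.
Proof. by rewrite hermC expr0 mul1r. Qed.

Lemma ip_linear (a : H) : linear (ip a : H -> R^o).
Proof. by move=> k x y; rewrite linearPr. Qed.

Lemma ip_linearl (k : R) (a b c : H) : ip (k *: a + b) c = k * ip a c + ip b c.
Proof. by rewrite ![ip _ c]ipC linearPr. Qed.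

(** The squared norm of [|b|^2 a - <a,b> b] equals [|b|^2 (|a|^2 |b|^2 - <a,b>^2)]. *)
Lemma ip_cauchy_schwarz (a b : H) : `|ip a b| <= `|a| * `|b|.
Proof.
have [->|b0] := eqVneq b 0; first by rewrite linear0r !normr0 mulr0.
have nb : 0 < `|b| ^+ 2 by rewrite exprn_gt0// normr_gt0.
rewrite -(@ler_pXn2r _ 2)// ?nnegrE ?mulr_ge0// real_normK ?num_real// exprMn.
rewrite -subr_ge0 -(pmulr_rge0 _ nb).
have := sqr_ge0 `|(`|b| ^+ 2) *: a + (- ip a b) *: b|; rewrite -(ip_norm UH).
have -> s t : ip (s *: a + t *: b) (s *: a + t *: b) =
    s ^+ 2 * `|a| ^+ 2 + 2 * s * t * ip a b + t ^+ 2 * `|b| ^+ 2.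
  have tb c : ip (t *: b) c = t * ip b c.
    by rewrite -[t *: b]addr0 ip_linearl linear0l addr0.
  rewrite ip_linearl tb ![ip _ (_ + _)]ipC !ip_linearl !tb !(ip_norm UH) (ipC b a).
  by ring.
by rewrite [X in 0 <= X -> _](_ : _ = `|b| ^+ 2 * (`|a| ^+ 2 * `|b| ^+ 2 - ip a b ^+ 2)) //; ring.
Qed.

Lemma iota_bounded : exists2 M : R, 0 < M & forall x, `|iota x| <= M * `|x|.
Proof.
have /linear_bounded_continuous/linear_boundedP := iota_continuous UH.
move=> /pinfty_ex_gt0[M M0 h]; by exists M.
Qed.

Lemma ip_iota_continuous (h : H) : continuous ((fun v => ip h (iota v)) : U -> R^o).
Proof.
have lin : linear ((fun v => ip h (iota v)) : U -> R^o).
  by move=> k x y; rewrite linearP ip_linear.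
pose fL := GRing.isLinear.Build R U R^o *:%R ((fun v => ip h (iota v)) : U -> R^o) lin.
pose F : {linear U -> R^o} := HB.pack ((fun v => ip h (iota v)) : U -> R^o) fL.
apply: (bounded_linear_continuous (f := F)); apply/linear_boundedP.
have [M M0 iM] := iota_bounded.
near=> k => x; apply: le_trans (ip_cauchy_schwarz _ _) _.
apply: (@le_trans _ _ (`|h| * M * `|x|)).
  by rewrite -mulrA ler_wpM2l.
by rewrite ler_wpM2r//; near: k; apply: nbhs_pinfty_ge; rewrite num_real.
Unshelve. all: by end_near. Qed.

Fact riesz_subproof (h : H) :
  ((fun v => ip h (iota v)) : U -> R^o) \in @dual_pred R U.
Proof.
rewrite inE; split; last exact: ip_iota_continuous.
by move=> k x y; rewrite linearP ip_linear.
Qed.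

Definition riesz (h : H) : dual U := Dual (riesz_subproof h).

Lemma representsE h f : represents ip iota h f <-> f = riesz h.
Proof.
split=> [hf|->//]; apply/val_inj/funext => v; exact: hf.
Qed.

Fact riesz_linear : linear riesz.
Proof.
move=> k a b; apply/val_inj/funext => v /=.
exact: ip_linearl.
Qed.

HB.instance Definition _ := GRing.isLinear.Build R H (dual U) *:%R riesz riesz_linear.

Lemma riesz_continuous : continuous riesz.
Proof.
apply: (bounded_linear_continuous (f := riesz)); apply/linear_boundedP.
have [M M0 iM] := iota_bounded.
near=> k => h; apply: (@le_trans _ _ (M * `|h|)).
  apply: dual_norm_le => v v1; apply: le_trans (ip_cauchy_schwarz _ _) _.
  rewrite mulrC ler_wpM2r//; apply: le_trans (iM _) _.
  by rewrite ler_piMr// ltW.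
by rewrite ler_wpM2r//; near: k; apply: nbhs_pinfty_ge; rewrite num_real.
Unshelve. all: by end_near. Qed.

Definition embed (x : U) : dual U := riesz (iota x).

Fact embed_linear : linear embed.
Proof. by move=> k a b; rewrite /embed (linearP iota); exact: riesz_linear. Qed.

HB.instance Definition _ := GRing.isLinear.Build R U (dual U) *:%R embed embed_linear.

Lemma embed_continuous : continuous embed.
Proof.
move=> x; apply: (@continuous_comp _ _ _ iota riesz); first exact: iota_continuous UH _.
exact: riesz_continuous.
Qed.

Lemma embed_sym x y : embed x y = embed y x.
Proof. exact: ipC. Qed.

(** H is dense in U' and U is dense in H; continuity of [riesz] pulls an open set of U' back to one
    of H. *)
Lemma embed_dense : dense (range embed).
Proof.
move=> O O0 oO.
have [f [Of [h /representsE fh]]] := H_dense UH O0 oO.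
have [||g [Og [x _ xg]]] := iota_dense UH (O := riesz @^-1` O).
- by exists h; rewrite /= -fh.
- by apply: open_comp => // ? _; exact: riesz_continuous.
by exists (embed x); split; [rewrite /embed xg|exists x].
Qed.

End Riesz.

(** * Borel sets and the inverse of the embedding *)

(** The measurable sets of this type are those of [borel], so the calculus of [measurable_fun]
    applies to [borel_fun]. *)
Notation borelT X := (g_sigma_algebraType (@open X)).

Section Borel.

Lemma borelC (X : topologicalType) (B : set X) : borel B -> borel (~` B).
Proof. by move=> bB; rewrite -setTD; exact: sigma_algebraCD. Qed.

Lemma borel_bigcup (X : topologicalType) (B : nat -> set X) :
  (forall n, borel (B n)) -> borel (\bigcup_n B n).
Proof. exact: sigma_algebra_bigcup. Qed.

Lemma borel_bigcap (X : topologicalType) (B : nat -> set X) :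
  (forall n, borel (B n)) -> borel (\bigcap_n B n).
Proof.
move=> bB; rewrite -[X in borel X]setCK setC_bigcap; apply: borelC.
by apply: borel_bigcup => n; exact: borelC.
Qed.

Lemma borelU (X : topologicalType) (B C : set X) : borel B -> borel C -> borel (B `|` C).
Proof.
move=> bB bC; rewrite -bigcup2E; apply: borel_bigcup => -[|[|n]] //=.
exact: sigma_algebra0.
Qed.

Lemma borelI (X : topologicalType) (B C : set X) : borel B -> borel C -> borel (B `&` C).
Proof. by move=> /borelC bB /borelC bC; rewrite -[B `&` C]setCK setCI; apply: borelC; exact: borelU. Qed.

Lemma open_borel (X : topologicalType) (B : set X) : open B -> borel B.
Proof. exact: sub_sigma_algebra. Qed.

Lemma closed_borel (X : topologicalType) (B : set X) : closed B -> borel B.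
Proof. by move=> cB; rewrite -[B]setCK; apply: borelC; apply: open_borel; exact: closed_openC. Qed.

Lemma borel_ind (X : topologicalType) (P : set X -> Prop) :
  P set0 -> (forall B, P B -> P (~` B)) ->
  (forall B : nat -> set X, (forall n, P (B n)) -> P (\bigcup_n B n)) ->
  (forall B, open B -> P B) -> forall B, borel B -> P B.
Proof.
move=> P0 PC PU Po; apply: smallest_sub => //; split => // B PB.
by rewrite setTD; exact: PC.
Qed.

Lemma open_borel_fun (X Y : topologicalType) (f : X -> Y) :
  (forall O, open O -> borel (f @^-1` O)) -> borel_fun f.
Proof.
move=> fo; apply: borel_ind => //.
- by rewrite preimage_set0; exact: sigma_algebra0.
- by move=> B bB; rewrite preimage_setC; exact: borelC.
- by move=> B bB; rewrite preimage_bigcup; exact: borel_bigcup.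
Qed.

Lemma continuous_borel_fun (X Y : topologicalType) (f : X -> Y) :
  continuous f -> borel_fun f.
Proof.
move=> cf; apply: open_borel_fun => O oO; apply: open_borel.
by apply: open_comp => // x _; exact: cf.
Qed.

Lemma borel_measurable_fun (X Y : ptopologicalType) (f : X -> Y) :
  borel_fun f -> measurable_fun setT (f : borelT X -> borelT Y).
Proof. by move=> bf _ B mB; rewrite setTI; exact: bf. Qed.

Lemma measurable_borel_fun (X Y : ptopologicalType) (f : X -> Y) :
  measurable_fun setT (f : borelT X -> borelT Y) -> borel_fun f.
Proof. by move=> mf B bB; rewrite -[_ @^-1` _]setTI; exact: mf. Qed.

Lemma continuous_borel_measurable (R : realType) (X : ptopologicalType) (f : X -> R) :
  continuous f -> measurable_fun setT (f : borelT X -> R).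
Proof.
move=> cf; apply: (measurability _ (RGenOInfty.measurableE R)).
move=> _ [_ [a ->] <-]; rewrite setTI; apply: open_borel.
apply: open_comp; first by move=> ? _; exact: cf.
by rewrite set_itvE; exact: open_gt.
Qed.

End Borel.

Section Separable.
Context {R : realType}.

Lemma separable_seq (X : normedModType R) : separable X ->
  exists d : nat -> X, forall x e, 0 < e -> exists n, `|x - d n| < e.
Proof.
move=> [D cD dD].
have ex x e : 0 < e -> exists2 y, D y & `|x - y| < e.
  move=> e0; have [|y [xy Dy]] := dD (ball x e) _ (ball_open x e).
    by exists x; exact: ballxx.
  by exists y => //; move: xy; rewrite -ball_normE.
have /pfcard_geP[D0|[d]] := cD.
  by have [y] := ex 0 1 ltr01; rewrite D0.
exists d => x e e0; have [y Dy xy] := ex x e e0.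
by have [n _ ny] := @surj _ _ _ _ d _ Dy; exists n; rewrite ny.
Qed.

(** An open set is a countable union of closed balls with centres [d n] and radii 1/(k+1). The
    second condition does not involve [x]: it empties the terms whose ball leaves [O], so that all
    pairs of indices can be kept. *)
Lemma open_bigcup_cball (X : normedModType R) (d : nat -> X) :
  (forall x e, 0 < e -> exists n, `|x - d n| < e) ->
  forall O : set X, open O ->
  O = \bigcup_n \bigcup_k [set x | `|x - d n| <= k.+1%:R^-1 /\
      (forall y, `|y - d n| <= k.+1%:R^-1 -> O y)].
Proof.
move=> dd O oO; apply/seteqP; split=> [x Ox|x [n _ [k _ [h1 h2]]]]; last exact: h2.
have [e /= e0 eO] := (nbhs_ballP _ _).1 (open_nbhs_nbhs (conj oO Ox)).
have e2 : 0 < e / 2 by rewrite divr_gt0.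
have [k _ /(_ k (leqnn k))/= ke] := near_infty_natSinv_lt (PosNum e2).
have [n xn] := dd x k.+1%:R^-1 ltac:(by rewrite invr_gt0).
exists n => //; exists k => //; split; first exact: ltW.
move=> y yn; apply: eO; rewrite -ball_normE /=.
rewrite -(subrKA (d n)) (le_lt_trans (ler_normD _ _))// [e]splitr ltrD//.
  exact: lt_trans ke.
by rewrite distrC (le_lt_trans yn).
Qed.

(** By [open_bigcup_cball], closed balls generate the Borel sets of a separable space. *)
Lemma cball_measurable_fun d (Om : measurableType d) (Y : normedModType R)
    (f : Om -> Y) : separable Y ->
  (forall y e, 0 <= e -> measurable [set x | `|f x - y| <= e]) ->
  measurable_fun setT (f : Om -> borelT Y).
Proof.
move=> /separable_seq[d' dd] fb; apply: (@measurability _ _ _ (borelT Y) _ f (@open Y)) => //.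
move=> _ [B oB <-]; rewrite setTI (open_bigcup_cball dd oB) preimage_bigcup.
apply: bigcup_measurable => n _; rewrite preimage_bigcup; apply: bigcup_measurable => k _.
have [kB|kB] := pselect (forall y, `|y - d' n| <= k.+1%:R^-1 -> B y).
  rewrite (_ : _ @^-1` _ = [set x | `|f x - d' n| <= k.+1%:R^-1]); first exact: fb.
  by apply/seteqP; split=> x //= [].
by rewrite (_ : _ @^-1` _ = set0)//; apply/seteqP; split=> x //= [].
Qed.

End Separable.

Section DualTheory.
Context {R : realType} (U : normedModType R).
Implicit Types (f g : dual U) (x y : U).

Lemma dual_le f x : `|f x| <= `|f| * `|x|.
Proof.
have [->|x0] := eqVneq x 0; first by rewrite linear0 !normr0 mulr0.
have nx : 0 < `|x| by rewrite normr_gt0.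
have : `|f (`|x|^-1 *: x)| <= `|f|.
  by apply: dual_norm_ub; rewrite normrZ gtr0_norm ?invr_gt0// mulVf// gt_eqF.
by rewrite linearZ/= normrM gtr0_norm ?invr_gt0// mulrC ler_pdivrMr.
Qed.

Lemma dual_eval_continuous x : continuous (fun f : dual U => f x : R).
Proof.
have lin : linear ((fun f : dual U => f x) : dual U -> R^o) by [].
pose fL := GRing.isLinear.Build R (dual U) R^o *:%R (fun f : dual U => f x) lin.
pose F : {linear dual U -> R^o} := HB.pack ((fun f => f x) : dual U -> R^o) fL.
apply: (bounded_linear_continuous (f := F)); apply/linear_boundedP.
near=> k => f; apply: le_trans (dual_le f x) _; rewrite mulrC.
have xk : `|x| <= k by near: k; apply: nbhs_pinfty_ge; rewrite num_real.
exact: ler_wpM2r.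
Unshelve. all: by end_near. Qed.

Lemma dual_dense_eq0 (d : nat -> U) (f : dual U) :
  (forall x e, 0 < e -> exists n, `|x - d n| < e) ->
  (forall n, f (d n) = 0) -> f = 0.
Proof.
move=> dd fd; apply/val_inj/funext => x /=.
apply/eqP; rewrite -normr_le0; apply/ler_addgt0Pr => e e0; rewrite add0r.
have f0 : 0 < `|f| + 1 by rewrite ltr_wpDl.
have [n xn] := dd x _ (divr_gt0 e0 f0).
rewrite -[f x]subr0 -(fd n) -linearB.
apply: le_trans (dual_le _ _) _.
rewrite ltr_pdivlMr// mulrC in xn; apply: le_trans (ltW xn).
by rewrite ler_wpM2r// lerDl.
Qed.

End DualTheory.

(** * Borel measurability of the inverse of a symmetric dense embedding *)

Section EmbedInverse.
Context {R : realType} {U : completeNormedModType R}.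
Variable J : {linear U -> dual U}.
Hypotheses (sepU : separable U) (Jsym : forall x y, J x y = J y x).
Hypotheses (Jcont : continuous J) (Jdense : dense (range J)).

Lemma embed_seq_dense (d : nat -> U) :
  (forall x e, 0 < e -> exists n, `|x - d n| < e) ->
  forall (f : dual U) e, 0 < e -> exists n, `|f - J (d n)| < e.
Proof.
move=> dd f e e0.
have [|g [fg [x _ xg]]] := Jdense (O := ball f e) _ (ball_open f e).
  by exists f; exact: ballxx.
have : nbhs x (J @^-1` (ball f e)).
  by apply: Jcont; apply: open_nbhs_nbhs; split; [exact: ball_open|rewrite xg].
move=> /nbhs_ballP[r /= r0 rJ]; have [n xn] := dd x r r0.
exists n; have := rJ (d n); rewrite -!ball_normE /=; exact.
Qed.

Lemma dual_separable : separable (dual U).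
Proof.
have [d dd] := separable_seq sepU.
exists (range (fun n => J (d n))); first exact: card_image_le.
move=> O [f Of] oO; have [e /= e0 eO] := (nbhs_ballP _ _).1 (open_nbhs_nbhs (conj oO Of)).
have [n fn] := embed_seq_dense dd f e0.
by exists (J (d n)); split; [apply: eO; rewrite -ball_normE|exists n].
Qed.

(* The functionals J y are norm-dense in the dual, hence norming; by symmetry they
   only see J x. *)
Lemma norm_embedP (d : nat -> U) (x : U) (c : R) : 0 <= c ->
  (forall x e, 0 < e -> exists n, `|x - d n| < e) ->
  (forall n, `|J x (d n)| <= c * `|J (d n)|) <-> `|x| <= c.
Proof.
move=> c0 dd; split=> [h|xc n]; last first.
  rewrite Jsym; apply: le_trans (dual_le _ _) _.
  by rewrite mulrC ler_wpM2r.
have [f fn fx] := norming_functional x.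
have f1 : `|f| <= 1 by apply: dual_norm_le => y; exact: le_trans.
apply/ler_addgt0Pr => e e0.
(* With [r = e / (c + |x| + 1)] the total error [r (c + |x|)] stays below [e]; the summand 1 keeps
   the denominator positive. *)
have k0 : 0 < c + `|x| + 1 by rewrite ltr_wpDl// addr_ge0.
have [n fJ] := embed_seq_dense dd f (divr_gt0 e0 k0).
set r := e / _ in fJ; have r0 : 0 <= r by exact: ltW (divr_gt0 e0 k0).
have -> : `|x| = J (d n) x + (f - J (d n)) x.
  by rewrite -[in LHS]fx; rewrite -[RHS]/(J (d n) x + (f x - J (d n) x)) addrC subrK.
apply: (@le_trans _ _ (c * (1 + r) + r * `|x|)).
  apply: lerD; last first.
    apply: le_trans (ler_norm _) _; apply: le_trans (dual_le _ _) _.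
    by rewrite ler_wpM2r// ltW.
  rewrite Jsym; apply: le_trans (ler_norm _) _; apply: le_trans (h n) _.
  rewrite ler_wpM2l//.
  rewrite -[J (d n)](subrKC f) (le_trans (ler_normD _ _))// lerD//.
  by rewrite distrC ltW.
have : r * (c + `|x| + 1) = e by rewrite /r mulfVK// gt_eqF.
lra.
Qed.

Lemma embed_inj : injective J.
Proof.
have [d dd] := separable_seq sepU.
move=> x y xy; apply/eqP; rewrite -subr_eq0 -normr_le0.
apply/(norm_embedP (d := d)) => // n.
by rewrite linearB/= xy subrr normr0 mul0r.
Qed.

(** Off the range the value is 0, so that Borel measurability there only asks that the range be
    Borel. *)
Definition embed_inv (f : dual U) : U :=
  if pselect (exists x, J x = f) is left p then sval (cid p) else 0.

Lemma embedK x : embed_inv (J x) = x.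
Proof.
rewrite /embed_inv; case: pselect => [p|[]]; last by exists x.
by apply: embed_inj; exact: svalP (cid p).
Qed.

(** For [g = J y], [c >= 0] and dense [d], this set meets the range of [J] in the image of the
    closed ball of U with centre [y] and radius [c]. It tests arbitrary functionals, through
    countably many closed conditions. *)
Definition embed_cball (d : nat -> U) (g : dual U) (c : R) : set (dual U) :=
  [set f | forall n, `|f (d n) - g (d n)| <= c * `|J (d n)|].

Lemma embed_cball_borel d g c : borel (embed_cball d g c).
Proof.
have -> : embed_cball d g c =
    \bigcap_n [set f : dual U | `|f (d n) - g (d n)| <= c * `|J (d n)|].
  by apply/seteqP; split=> [f h n _|f h n]; exact: h.
apply: borel_bigcap => n; apply: closed_borel.
apply: (preimage_closed (f := fun f : dual U => `|f (d n) - g (d n)| : R)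
  (D := [set z | z <= c * `|J (d n)|])); last exact: closed_le.
move=> f _.
have fn := @dual_eval_continuous _ _ (d n) f.
exact: (cvg_norm (cvgB fn (cvg_cst (g (d n) : R)))).
Qed.

Lemma embed_cballE d x y c : 0 <= c ->
  (forall x e, 0 < e -> exists n, `|x - d n| < e) ->
  embed_cball d (J y) c (J x) <-> `|x - y| <= c.
Proof.
move=> c0 dd; rewrite -(norm_embedP _ c0 dd).
by split=> h n; have := h n; rewrite linearB.
Qed.

(** If [f] lies in such a set of radius 1/(k+1) around some [J (d (m k))] for every [k], the centres
    [d (m k)] form a Cauchy sequence in U, and [J] maps its limit to [f]. *)
Lemma range_embedE (d : nat -> U) :
  (forall x e, 0 < e -> exists n, `|x - d n| < e) ->
  range J = \bigcap_k \bigcup_n embed_cball d (J (d n)) k.+1%:R^-1.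
Proof.
move=> dd; apply/seteqP; split=> [_ [x _ <-] k _|f fJ].
  have [n xn] := dd x k.+1%:R^-1 ltac:(by rewrite invr_gt0).
  by exists n => //; apply/embed_cballE => //; exact: ltW.
have /choice[m fm] k : exists n, embed_cball d (J (d n)) k.+1%:R^-1 f.
  by have [n _ fn] := fJ k I; exists n.
(* As [f] is not yet known to have a preimage, the triangle inequality is applied to the values at
   [d n] and only then turned into a norm estimate in U. *)
have dm k l : `|d (m k) - d (m l)| <= k.+1%:R^-1 + l.+1%:R^-1.
  apply/(embed_cballE _ _ _ dd); first by rewrite addr_ge0.
  move=> n; rewrite -(subrKA (f (d n))) (le_trans (ler_normD _ _))//.
  by rewrite mulrDl; apply: lerD; [rewrite distrC|]; exact: fm.
have /cauchy_cvgP/cvg_ex[x dx] : cauchy (d (m k) @[k --> \oo]).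
  apply/cauchyP => e e0; have e2 : 0 < e / 2 by rewrite divr_gt0.
  have [N _ Ne] := near_infty_natSinv_lt (PosNum e2).
  exists (d (m N)); exists N => // k /= Nk; rewrite -ball_normE/=.
  rewrite (le_lt_trans (dm _ _))// [e]splitr ltrD//; first exact: (Ne N (leqnn N)).
  exact: Ne.
exists x => //; apply/eqP; rewrite -subr_eq0; apply/eqP.
apply: (dual_dense_eq0 dd) => n; apply/eqP; rewrite -normr_le0; apply/ler_addgt0Pr => e e0.
have C0 : 0 < `|J (d n)| + 1 by rewrite ltr_wpDl.
have e2 : 0 < e / 2 / (`|J (d n)| + 1) by rewrite !divr_gt0.
have [k [xk ke]] : exists k, `|x - d (m k)| < e / 2 / (`|J (d n)| + 1) /\
    k.+1%:R^-1 < e / 2 / (`|J (d n)| + 1).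
  move/cvgrPdist_lt: dx => /(_ _ e2) xk.
  have := filterI xk (near_infty_natSinv_lt (PosNum e2)).
  by case=> N _ /(_ N (leqnn N))/= [h1 h2]; exists N.
rewrite add0r -[(J x - f) (d n)]/(J x (d n) - f (d n)).
rewrite -(subrKA (J (d (m k)) (d n))) (le_trans (ler_normD _ _))//.
apply: (@le_trans _ _ ((`|x - d (m k)| + k.+1%:R^-1) * (`|J (d n)| + 1))).
  rewrite mulrDl lerD//.
    rewrite -[J x (d n) - _]/((J x - J (d (m k))) (d n)) -linearB Jsym.
    apply: le_trans (dual_le _ _) _; rewrite mulrC ler_wpM2l// lerDl//.
  rewrite distrC; apply: le_trans (fm _ _) _.
  by rewrite ler_wpM2l// lerDl.
rewrite -ler_pdivlMr// [e in e / _]splitr mulrDl; apply: lerD; exact: ltW.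
Qed.

(** The preimage of a closed ball is an [embed_cball] within the range of [J], and everything or
    nothing outside it. *)
Lemma embed_inv_borel : borel_fun embed_inv.
Proof.
have [d dd] := separable_seq sepU.
have bR : borel (range J).
  rewrite (range_embedE dd); apply: borel_bigcap => k; apply: borel_bigcup => n.
  exact: embed_cball_borel.
apply: measurable_borel_fun; apply: cball_measurable_fun => // y e e0.
change (borel [set f | `|embed_inv f - y| <= e]).
have invN f : ~ range J f -> embed_inv f = 0.
  by move=> nf; rewrite /embed_inv; case: pselect => // -[x xf]; case: nf; exists x.
have -> : [set f | `|embed_inv f - y| <= e] =
    (range J `&` embed_cball d (J y) e) `|`
    (~` range J `&` [set _ | `|0 - y| <= e]).
  apply/seteqP; split=> [f /= fe|f [[[x _ <-]]|[nf /= ye]]].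
  - have [[x _ xf]|nf] := pselect (range J f).
      left; split; first by exists x.
      by rewrite -xf; apply/(embed_cballE _ _ e0 dd); move: fe; rewrite -xf embedK.
    by right; split=> //; move: fe; rewrite invN.
  - by move/(embed_cballE _ _ e0 dd) => /=; rewrite embedK.
  - by rewrite /= invN.
apply: borelU; apply: borelI => //; first exact: embed_cball_borel.
  exact: borelC.
have [yc|yc] := boolP (`|0 - y| <= e).
  by rewrite (_ : [set _ | _] = setT) ?predeqE//; apply: open_borel; exact: openT.
by rewrite (_ : [set _ | _] = set0) ?predeqE//; apply: open_borel; exact: open0.
Qed.

End EmbedInverse.

(** * Paths and measurability *)

Section Paths.
Context {R : realType} (T : R) (E : normedModType R).
Implicit Types (w v : CT T E) (t : time T).

Lemma CT_nbhsP w (P : set (CT T E)) :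
  nbhs w P <-> exists2 e : R, 0 < e & forall v, (forall t, `|w t - v t| < e) -> P v.
Proof.
split.
  move=> -[_ [[B oB <-] /= Bw] BP].
  have /uniform_nbhs[F [eF FB]] : nbhs (w : {uniform time T -> E}) B.
    by apply: open_nbhs_nbhs.
  move: eF; rewrite -entourage_ballE => -[e /= e0 eF].
  exists e => // v wv; apply/BP/FB => t _; apply: eF => /=.
  by rewrite -ball_normE; exact: wv.
move=> [e e0 eP].
have wB : nbhs (w : {uniform time T -> E}) [set h | forall t, `|w t - h t| < e].
  apply/uniform_nbhs; exists [set xy | ball xy.1 e xy.2]; split.
    by rewrite -entourage_ballE; exists e.
  by move=> h /= wh t; have := wh t I; rewrite -ball_normE.
have wB' : nbhs w [set h : CT T E | forall t, `|w t - h t| < e].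
  exact: (@initial_continuous _ _
    (fun f : continuousType (time T) E => (f : {uniform time T -> E})) w _ wB).
by apply: filterS wB' => v; exact: eP.
Qed.

Lemma CT_eval_continuous t : continuous (fun w => w t).
Proof.
move=> w A /nbhs_ballP[e /= e0 eA]; apply/CT_nbhsP; exists e => // v wv.
by apply: eA; rewrite -ball_normE; exact: wv.
Qed.

Lemma CT_eqP w v : (forall t, w t = v t) -> w = v.
Proof. by move=> wv; apply/continuousEP. Qed.

Lemma CT_hausdorff : hausdorff_space (CT T E).
Proof.
move=> w v wv; apply: CT_eqP => t; apply: (@norm_hausdorff _ E) => A B Aw Bv.
have := wv _ _ (@CT_eval_continuous t w A Aw) (@CT_eval_continuous t v B Bv).
by case=> z [Az Bz]; exists (z t).
Qed.

Hypothesis T0 : 0 < T.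

Lemma clamp_subproof (s : R) : Num.max 0 (Num.min s T) \in `[0, T]%classic.
Proof.
by rewrite inE /= in_itv /= le_max lexx /= ge_max (ltW T0) ge_min lexx orbT.
Qed.

(** The retraction of the line onto [0,T]. Composed with it, a path on the subtype [time T] becomes
    a function of a real variable that can be integrated and sampled at rationals. *)
Definition clamp (s : R) : time T := SigSub (clamp_subproof s).

Lemma clampK t : clamp (\val t) = t.
Proof.
apply: val_inj => /=; have := valP t; rewrite inE /= in_itv /= => /andP[t0 tT].
by rewrite min_l// max_r.
Qed.

Lemma clamp_id (s : R) (sT : s \in `[0, T]%classic) : clamp s = SigSub sT.
Proof. by rewrite -[SigSub sT]clampK. Qed.

Lemma clamp_continuous : continuous clamp.
Proof.
apply/continuousP => A [B oB <-].
have cm : continuous (fun s : R => Num.max 0 (Num.min s T)).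
  move=> s; apply: (@continuous_max _ _ (cst 0) (id \min cst T)); first exact: cvg_cst.
  by apply: continuous_min; [exact: cvg_id|exact: cvg_cst].
by move/continuousP: cm => /(_ B oB).
Qed.

Lemma path_continuous w : continuous (fun s : R => w (clamp s)).
Proof.
move=> s; apply: (@continuous_comp _ _ _ clamp w); first exact: clamp_continuous.
exact: cts_fun.
Qed.

End Paths.

(** * Strong and Borel measurability in separable spaces *)

Section StrongMeasurability.
Context {R : realType} (X : normedModType R).

Lemma simple_map_preimage (Y : Type) (s : R -> Y) (C : set Y) :
  simple_map s -> measurable (s @^-1` C).
Proof.
move=> [fs ms].
rewrite (_ : _ @^-1` _ = \bigcup_(x in [set x | range s x /\ C x]) (s @^-1` [set x])).
  apply: fin_bigcup_measurable; first by apply: sub_finite_set fs => y [].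
  by move=> x _; exact: ms.
apply/seteqP; split=> [t /= tB|t [x [_ Bx] /= ->]]//.
by exists (s t) => //; split=> //; exists t.
Qed.

(** The limit lies in an open [B] exactly when, for some [k], the approximants eventually lie in the
    set [C k] of points whose 1/(k+1)-ball is inside [B]. *)
Lemma strongly_measurable_fun (D : set R) (f : R -> X) :
  measurable D -> strongly_measurable D f -> measurable_fun D (f : R -> borelT X).
Proof.
move=> mD [s [ss sf]]; apply: (@measurability _ _ _ (borelT X) D f (@open X)) => //.
move=> _ [B oB <-].
pose C k := [set x : X | forall y, `|x - y| < k.+1%:R^-1 -> B y].
have -> : D `&` f @^-1` B =
    D `&` \bigcup_k \bigcup_N \bigcap_(n in [set n | (N <= n)%N]) (s n @^-1` C k).
  apply/seteqP; split=> [t [Dt]|t [Dt]].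
    move=> Bft; split=> //.
    have [e /= e0 eO] := (nbhs_ballP _ _).1 (open_nbhs_nbhs (conj oB Bft)).
    have e2 : 0 < e / 2 by rewrite divr_gt0.
    have [k _ /(_ k (leqnn k))/= ke] := near_infty_natSinv_lt (PosNum e2).
    have /cvgrPdist_lt/(_ (e / 2) e2)[N _ Nf] := sf t Dt.
    exists k => //; exists N => // n /= Nn y sny; apply: eO; rewrite -ball_normE /=.
    rewrite -(subrKA (s n t)) (le_lt_trans (ler_normD _ _))// [e]splitr ltrD//.
      exact: Nf.
    exact: lt_trans ke.
  move=> [k _ [N _ sC]]; split=> //.
  have k0 : 0 < k.+1%:R^-1 :> R by rewrite invr_gt0.
  have /cvgrPdist_lt/(_ _ k0)[M _ Mf] := sf t Dt.
  apply: (sC (maxn N M)); first exact: leq_maxl.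
  by rewrite distrC; apply: Mf; exact: leq_maxr.
apply: measurableI => //; apply: bigcup_measurable => k _; apply: bigcup_measurable => N _.
by apply: bigcap_measurableType => n _; exact: simple_map_preimage.
Qed.

(** The approximants send [t] to the point nearest to [f t] among the first terms of a dense
    sequence. *)
Lemma measurable_strongly (D : set R) (f : R -> X) : measurable D -> separable X ->
  measurable_fun D (f : R -> borelT X) -> strongly_measurable D f.
Proof.
move=> mD /separable_seq[d dd] mf.
pose A m n := [set t | D t /\ `|f t - d n| < `|f t - d m|].
have mA m n : measurable (A m n).
  have := mf mD [set x | `|x - d n| < `|x - d m|]; apply.
  apply: sub_sigma_algebra => /=.
  rewrite (_ : [set x | _] = (fun x => `|x - d m| - `|x - d n|) @^-1` [set y | 0 < y]).
    apply: open_comp; last exact: open_gt.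
    move=> x _; apply: cvgB; apply: cvg_norm; apply: cvgB;
      [exact: cvg_id|exact: cvg_cst|exact: cvg_id|exact: cvg_cst].
  by apply/seteqP; split=> x /=; rewrite subr_gt0.
(* On [D], [i n t] is the first index at which [d 0, ..., d n] come nearest to [f t]: it changes
   only under strict improvement. Off [D] it stays 0. *)
pose i := fix i n t : nat := if n is p.+1 then
  if `[< A (i p t) n t >] then n else i p t else 0%N.
have iS n t : i n.+1 t = if `[< A (i n t) n.+1 t >] then n.+1 else i n t by [].
have in_ n t : (i n t <= n)%N.
  by elim: n => // n IH; rewrite iS; case: ifP => // _; exact: leqW.
have mi n m : measurable (i n @^-1` [set m]).
  elim: n m => [|n IH] m.
    by rewrite preimage_cst; case: ifP => _.
  rewrite (_ : _ @^-1` _ = (\bigcup_l (i n @^-1` [set l] `&` A l n.+1) `&` [set _ | m = n.+1])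
      `|` (i n @^-1` [set m] `&` ~` A m n.+1)).
    apply: measurableU; apply: measurableI => //.
    - by apply: bigcup_measurable => l _; exact: measurableI.
    - have [->|mn] := pselect (m = n.+1).
        by rewrite (_ : [set _ | _] = setT)//; apply/seteqP; split.
      by rewrite (_ : [set _ | _] = set0)//; apply/seteqP; split.
    - exact: measurableC.
  apply/seteqP; split=> t /=.
    case: asboolP => [At <-|nA <-]; last by right.
    by left; split=> //; exists (i n t).
  case=> [[[l _ [itl At]] ->]|[itm nA]].
    by case: asboolP => //; rewrite itl.
  by case: asboolP => //; rewrite itm.
exists (fun n t => d (i n t)); split=> [n|t Dt].
  split.
    have : finite_set (d @` `I_n.+1) by exact/finite_image/finite_II.
    by apply: sub_finite_set => _ [t _ <-]; exists (i n t) => //=; rewrite ltnS.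
  move=> x; rewrite (_ : _ @^-1` _ = \bigcup_(m in [set m | d m = x]) (i n @^-1` [set m])).
    by apply: bigcup_measurable => m _; exact: mi.
  by apply/seteqP; split=> [t /= tx|t [m /= mx]/= ->//]; exists (i n t).
have id_ m n : (m <= n)%N -> `|f t - d (i n t)| <= `|f t - d m|.
  elim: n => [|n IH].
    by rewrite leqn0 => /eqP ->.
  rewrite leq_eqVlt ltnS => mn; rewrite iS; case: asboolP => [[_ At]|nA].
    move: mn => /orP[/eqP->//|/IH]; apply: le_trans; exact: ltW.
  move: mn => /orP[/eqP->|/IH//].
  by rewrite leNgt; apply/negP => h; exact: nA.
apply/cvgrPdist_lt => e e0; have [m fm] := dd (f t) e e0.
by exists m => // n /= mn; exact: le_lt_trans (id_ _ _ mn) fm.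
Qed.

Lemma strongly_measurableP (D : set R) (f : R -> X) : measurable D -> separable X ->
  strongly_measurable D f <-> measurable_fun D (f : R -> borelT X).
Proof. by move=> mD sX; split; [exact: strongly_measurable_fun|exact: measurable_strongly]. Qed.

End StrongMeasurability.

(** * Compact sets and inner regularity *)

Section CompactProjection.

(** For [y] in the closure of the projection, the first coordinates of the points of [C] over
    neighbourhoods of [y] generate a filter containing [K]. It clusters at some [k] in [K], and
    [(k, y)] lies in the closed set [C]. *)
Lemma compact_closed_image_snd (X Y : topologicalType) (K : set X) (C : set (X * Y)) :
  compact K -> (forall p, C p -> K p.1) -> closed C -> closed (snd @` C).
Proof.
move=> cK CK cC y yC.
pose F : set_system X := filter_from (nbhs y) (fun V => [set x | exists2 y', V y' & C (x, y')]).
have FF : ProperFilter F.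
  apply: filter_from_proper; last first.
    move=> V Vy; have [_ [[[x y'] /= Cxy <-] Vy']] := yC V Vy.
    by exists x, y'.
  apply: filter_from_filter; first by exists setT; exact: filterT.
  move=> V W Vy Wy; exists (V `&` W); first exact: filterI.
  by move=> x [y' [Vy' Wy'] Cxy]; split; exists y'.
have FK : F K by exists setT; [exact: filterT|move=> x [y' _ /CK]].
have [k [Kk kF]] := cK F FF FK.
exists (k, y) => //; apply: cC => B [[V W] /= [Vk Wy] VWB].
have FW : F [set x | exists2 y', W y' & C (x, y')] by exists W.
have [x [[y' Wy' Cxy] Vx]] := kF _ _ FW Vk.
by exists (x, y'); split=> //; exact: VWB.
Qed.

Lemma closed_graph (X Z W : topologicalType) (f : X -> Z) (g : W -> Z) :
  hausdorff_space Z -> continuous f -> continuous g ->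
  closed [set p : X * W | f p.1 = g p.2].
Proof.
move=> hZ cf cg -[x w] xw; apply: hZ => A B fA gB /=.
have nb : nbhs (x, w) [set p | A (f p.1) /\ B (g p.2)].
  by exists (f @^-1` A, g @^-1` B); [split; [exact: cf|exact: cg]|move=> [? ?] [? ?]].
have [[x' w'] [/= fg [Ax' Bw']]] := xw _ nb.
by exists (f x'); split=> //; rewrite fg.
Qed.

Lemma continuous_inj_hausdorff (X Z : topologicalType) (h : X -> Z) :
  hausdorff_space Z -> continuous h -> injective h -> hausdorff_space X.
Proof.
move=> hZ ch ih x y xy; apply/ih/hZ => A B Ax By.
by have [z [Az Bz]] := xy _ _ (ch _ _ Ax) (ch _ _ By); exists (h z).
Qed.

(* A continuous injection into a Hausdorff space is a homeomorphism on compact sets. *)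
Lemma borel_compact_transfer (X Y Z : topologicalType) (h : X -> Z) (K : set X)
    (B : set (X * Y)) :
  hausdorff_space Z -> continuous h -> injective h -> compact K -> borel B ->
  exists2 B' : set (Z * Y), borel B' &
    forall x y, K x -> B (x, y) <-> B' (h x, y).
Proof.
move=> hZ ch ih cK; move: B; apply: borel_ind.
- by exists set0 => //; exact: sigma_algebra0.
- move=> B [B' bB' BB']; exists (~` B'); first exact: borelC.
  by move=> x y Kx /=; rewrite BB'.
- move=> B IH.
  have /choice[B' BB'] : forall n, exists B', borel B' /\
      forall x y, K x -> B n (x, y) <-> B' (h x, y).
    by move=> n; have [B' bB' BB'] := IH n; exists B'.
  exists (\bigcup_n B' n); first by apply: borel_bigcup => n; case: (BB' n).
  by move=> x y Kx; split=> -[n _ Bn]; exists n => //; case: (BB' n) => _ /(_ x y Kx) [];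
    [move=> + _|move=> _]; exact.
move=> B oB.
have cK' : closed K by apply: compact_closed => //; exact: continuous_inj_hausdorff ih.
(* For open [B], the points [(h x, y)] with [x] in [K] and [(x, y)] outside [B] form the projection
   of [D] along [K]. It is closed, and its complement is the set sought. *)
pose D : set (X * (Z * Y)) := [set p | K p.1 /\ ~ B (p.1, p.2.2) /\ h p.1 = p.2.1].
have cD : closed D.
  rewrite (_ : D = fst @^-1` K `&` ((fun p => (p.1, p.2.2)) @^-1` (~` B) `&`
      [set p : X * (Z * Y) | h p.1 = p.2.1])); last by [].
  apply: closedI; last apply: closedI.
  - by apply: preimage_closed => // p _; exact: cvg_fst.
  - apply: preimage_closed; last exact: open_closedC.
    move=> [x [z y]] _; apply: cvg_pair; first exact: cvg_fst.
    apply: (@cvg_comp _ _ _ snd snd); [exact: cvg_snd|exact: cvg_snd].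
  - by apply: closed_graph => // p; exact: cvg_fst.
exists (~` (snd @` D)).
  apply: borelC; apply: closed_borel.
  by apply: (compact_closed_image_snd cK) => // p [].
move=> x y Kx; split=> [Bxy [[x' [z y']] /= [_ [/= nB hz]] [zx yy]]|nD].
  by apply: nB; rewrite yy (_ : x' = x)//; apply: ih; rewrite hz.
apply: contrapT => nB; apply: nD; exists (x, (h x, y)) => //.
Qed.

End CompactProjection.

(** * Inner regularity of laws on spaces whose closed sets are G-delta *)

Section Regularity.
Context {R : realType} d (Om : measurableType d) (P : probability Om R).
Variables (X : topologicalType) (f : Om -> X).
Hypothesis rf : Defs.random_variable f.
Hypothesis closed_Gdelta : forall C : set X, closed C ->
  exists2 W : nat -> set X, (forall n, open (W n)) & C = \bigcap_n W n.

Let mpre B : borel B -> measurable (f @^-1` B).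
Proof. exact: rf. Qed.

(** Continuity from above along the sets [V] minus finite unions of the [F i], which are closed. *)
Let finite_closed (F : nat -> set X) (V : set X) (e : \bar R) :
  (forall n, closed (F n)) -> borel V -> (P (f @^-1` (V `\` \bigcup_n F n)) < e)%E ->
  exists2 G, closed G & G `<=` \bigcup_n F n /\ (P (f @^-1` (V `\` G)) < e)%E.
Proof.
move=> cF bO Pe; pose G n := \big[setU/set0]_(i < n) F i.
have cG n : closed (G n).
  by rewrite /G -bigcup_mkord; apply: closed_bigcup => // i _; exact: cF.
have mG n : measurable (f @^-1` (V `\` G n)).
  by apply: mpre; apply: borelI => //; apply: borelC; exact: closed_borel.
have GE : \bigcap_n f @^-1` (V `\` G n) = f @^-1` (V `\` \bigcup_n F n).
  apply/seteqP; split=> om /=.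
    move=> h; split; first by case: (h 0 I).
    move=> [n _ Fn]; case: (h n.+1 I) => _; apply.
    by rewrite /G -bigcup_mkord; exists n => /=.
  move=> [Oom nF] n _; split=> // Gn; apply: nF.
  by move: Gn; rewrite /G -bigcup_mkord => -[i _ Fi]; exists i.
have := @nonincreasing_cvg_mu _ _ _ P (fun n => f @^-1` (V `\` G n)).
move=> /(_ _ mG); rewrite GE => /(_ _ _ _)/(_ [set y | (y < e)%E]) [].
- by rewrite (le_lt_trans (probability_le1 _ (mG 0%N)))// ltry.
- apply: mpre; apply: borelI => //; apply: borelC; apply: borel_bigcup => n.
  exact: closed_borel.
- move=> n m nm; apply/subsetPset => om [Oo nG]; split=> // Gn; apply: nG.
  move: Gn; rewrite /G -!bigcup_mkord => -[i /= im Fi]; exists i => //=.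
  exact: leq_trans nm.
- by apply: open_nbhs_nbhs; split=> //; exact: open_ereal_lt_ereal.
move=> N _ /(_ N (leqnn N)) /= PN; exists (G N) => //; split=> //.
by rewrite /G -bigcup_mkord => x [i _ Fi]; exists i.
Qed.

(** The sets approximable by closed sets from inside and open sets from outside form a
    sigma-algebra. Asking for both makes the class stable under complements; open sets belong to it
    because they are F-sigma. *)
Lemma borel_regular (B : set X) : borel B -> forall e : R, 0 < e ->
  exists F V : set X, [/\ closed F, open V, F `<=` B, B `<=` V &
    (P (f @^-1` (V `\` F)) < e%:E)%E].
Proof.
move: B; apply: borel_ind.
- move=> e e0; exists set0, set0; split=> //; [exact: closed0|exact: open0|].
  by rewrite set0D preimage_set0 measure0 lte_fin.
- move=> B IH e /IH[F [V [cF oO FB BO Pe]]].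
  exists (~` V), (~` F); split; [exact: open_closedC|exact: closed_openC|..].
  + exact: subsetC.
  + exact: subsetC.
  + by rewrite setDE setCK setIC -setDE.
- move=> B IH e e0.
  (* These errors sum to [e / 2], which leaves the strict inequality that [finite_closed] requires
     to pass to finitely many closed sets. *)
  have en n : 0 < e / 2 / (2 ^ n.+1)%:R :> R by rewrite !divr_gt0 ?ltr0n ?expn_gt0.
  have /choice[F FO] : forall n, exists F, exists V, [/\ closed F, open V, F `<=` B n, B n `<=` V &
      (P (f @^-1` (V `\` F)) < (e / 2 / (2 ^ n.+1)%:R)%:E)%E].
    by move=> n; exact: IH.
  have {FO}/choice[V FO] := FO.
  have bF n : borel (F n) by case: (FO n) => h *; exact: closed_borel.
  have bO n : borel (V n) by case: (FO n) => _ h *; exact: open_borel.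
  have bU : borel (\bigcup_n V n) by exact: borel_bigcup.
  have bUF : borel (\bigcup_n F n) by exact: borel_bigcup.
  have Pe : (P (f @^-1` (\bigcup_n V n `\` \bigcup_n F n)) < e%:E)%E.
    apply: (@le_lt_trans _ _ (e / 2)%:E); last by rewrite lte_fin ltr_pdivrMr// ltr_pMr// ltr1n.
    apply: (@le_trans _ _ (\sum_(0 <= n <oo) P (f @^-1` (V n `\` F n)))%E).
      apply: measure_sigma_subadditive.
      + by move=> n; apply: mpre; apply: borelI => //; exact: borelC.
      + by apply: mpre; apply: borelI => //; exact: borelC.
      + move=> om [[n _ On] nF]; exists n => //; split=> // Fn; apply: nF; exists n => //.
    have := @epsilon_trick R (fun=> 0%E) (e / 2) xpredT (fun=> lexx _) (ltW (divr_gt0 e0 (ltr0Sn R 1))).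
    rewrite [X in (_ <= X + _)%E]eseries0// add0e; apply: le_trans.
    by apply: lee_nneseries => // n _; rewrite add0e ltW//; case: (FO n).
  have cF n : closed (F n) by case: (FO n).
  have [G cG [GF PG]] := finite_closed cF bU Pe.
  exists G, (\bigcup_n V n); split=> //.
  + by apply: bigcup_open => n _; case: (FO n).
  + by apply: subset_trans GF _ => x [n _ Fn]; exists n => //; case: (FO n) => _ _ h _ _; exact: h.
  + by move=> x [n _ Bn]; exists n => //; case: (FO n) => _ _ _ h _; exact: h.
- move=> B oB e e0; have [W oW WB] := closed_Gdelta (open_closedC oB).
  have BE : B = \bigcup_n ~` W n by rewrite -[LHS]setCK WB setC_bigcap.
  have [|||G cG [GW PG]] := @finite_closed (fun n => ~` W n) B e%:E.
  + by move=> n; exact: open_closedC.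
  + exact: open_borel.
  + by rewrite -BE setDv preimage_set0 measure0 lte_fin.
  by exists G, B; split=> //; rewrite BE.
Qed.

Lemma borel_inner_Fsigma (B : set X) : borel B -> exists F : nat -> set X,
  [/\ forall n, closed (F n), \bigcup_n F n `<=` B & P (f @^-1` (B `\` \bigcup_n F n)) = 0%E].
Proof.
move=> bB.
have /choice[F FP] : forall n, exists F, [/\ closed F, F `<=` B &
    (P (f @^-1` (B `\` F)) < (n.+1%:R^-1)%:E)%E].
  move=> n; have [|F [V [cF oO FB BO PF]]] := @borel_regular B bB (n.+1%:R^-1).
    by rewrite invr_gt0.
  exists F; split=> //; apply: le_lt_trans PF.
  have bF := closed_borel cF; have bO := open_borel oO.
  apply: le_measure; rewrite ?inE.
  - by apply: mpre; apply: borelI => //; exact: borelC.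
  - by apply: mpre; apply: borelI => //; exact: borelC.
  - by move=> om [/= /BO].
have cF n : closed (F n) by case: (FP n).
exists F; split=> //; first by move=> x [n _ Fn]; case: (FP n) => _ h _; exact: h.
apply/eqP; rewrite eq_le measure_ge0 andbT; apply/lee_addgt0Pr => e e0; rewrite add0e.
have [n _ /(_ n (leqnn n))/= ne] := near_infty_natSinv_lt (PosNum e0).
have [_ _ Pn] := FP n.
apply: (@le_trans _ _ (P (f @^-1` (B `\` F n)))); last first.
  by apply: ltW; apply: lt_trans Pn _; rewrite lte_fin.
apply: le_measure; rewrite ?inE.
- apply: mpre; apply: borelI => //; apply: borelC; apply: borel_bigcup => m.
  exact: closed_borel.
- by apply: mpre; apply: borelI => //; apply: borelC; exact: closed_borel.
- by move=> om [/= Bo nF]; split=> // Fn; apply: nF; exists n.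
Qed.

End Regularity.

(** * The graph of the equation *)

HB.instance Definition _ (X Y : ptopologicalType) := Pointed.on (X * Y)%type.

Section PathMeasurability.
Context {R : realType} (T : R) (T0 : 0 < T) (E : normedModType R).

Definition path_cst (x : E) : CT T E := mkcts (@cst_continuous (time T) E x).
HB.instance Definition _ := isPointed.Build (CT T E) (path_cst 0).

(* The path space need not be separable here: continuity in time reduces the event
   to countably many measurable rectangles. *)
Lemma path_eval_measurable : separable E ->
  measurable_fun setT
    ((fun p => p.1 (clamp T0 p.2)) : (borelT (CT T E) * R)%type -> borelT E).
Proof.
move=> sE; apply: cball_measurable_fun => // y e e0.
pose phi (w : CT T E) s : R := `|w (clamp T0 s) - y|.
have cphi w : continuous (phi w).
  move=> s; apply: cvg_norm; apply: cvgB; last exact: cvg_cst.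
  exact: path_continuous.
have mphi s c : measurable ([set w | phi w s < c] : set (borelT (CT T E))).
  apply: sub_sigma_algebra => /=.
  apply: (open_comp (f := phi^~ s) (D := [set z | z < c])); last exact: open_lt.
  move=> w _; apply: (cvg_norm (cvgB (@CT_eval_continuous _ _ _ (clamp T0 s) w) (cvg_cst y))).
(* By continuity in time, [phi w s <= e] holds exactly when for each [k] some rational [q] within
   1/(k+1) of [s] satisfies [phi w q < e + 1/(k+1)]. Each such condition is a rectangle. *)
rewrite (_ : [set _ | _] = \bigcap_k \bigcup_(q : rat)
    ([set w | phi w (ratr q) < e + k.+1%:R^-1] `*` ball (ratr q : R) k.+1%:R^-1)).
  apply: bigcap_measurableType => k _; apply: countable_bigcupT_measurable => // q.
  apply: measurableX; first exact: mphi.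
  exact: measurable_ball.
apply/seteqP; split=> [[w s] /= ws k _|[w s] /= ws].
  have k0 : 0 < k.+1%:R^-1 :> R by rewrite invr_gt0.
  have : nbhs s ([set s' | phi w s' < e + k.+1%:R^-1] `&` ball s k.+1%:R^-1).
    apply: filterI; last exact: nbhsx_ballx.
    apply: (cphi w s [set z | z < e + k.+1%:R^-1]).
    apply: open_nbhs_nbhs; split; first exact: open_lt.
    by rewrite /= (le_lt_trans ws)// ltrDl.
  rewrite nbhsE => -[B [oB Bs] BS].
  have [|x [/BS [h1 h2] [q _ qx]]] := @dense_rat R B _ oB; first by exists s.
  by exists q => //; rewrite -qx in h1 h2; split => //=; exact: ball_sym.
apply/ler_addgt0Pr => c c0; have c2 : 0 < c / 2 by rewrite divr_gt0.
have /cvgrPdist_lt/(_ _ c2)/nbhs_ballP[r /= r0 rs] := cphi w s.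
have m0 : 0 < Num.min (c / 2) r by rewrite lt_min c2.
have [k _ /(_ k (leqnn k))/= kc] := near_infty_natSinv_lt (PosNum m0).
move: kc; rewrite /= lt_min => /andP[kc kr].
have [q _ [/= h1 h2]] := ws k I.
have h3 : phi w s - phi w (ratr q) < c / 2.
  exact: le_lt_trans (ler_norm _) (rs (ratr q) (le_ball (ltW kr) (ball_sym h2))).
rewrite -/(phi w s); apply: ltW.
rewrite [c]splitr addrA -(subrK (phi w (ratr q)) (phi w s)) addrC ltrD//.
by rewrite (lt_trans h1)// ltrD2l.
Qed.

End PathMeasurability.

(** * Measurable dependence of integrals on a parameter *)

Section ParametricIntegral.
Context {R : realType} d (W : measurableType d).
Local Notation mu := (@lebesgue_measure R).

(** Tonelli's theorem for [g] extended by 0 outside [D]. *)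
Lemma measurable_param_integral (g : W * R -> \bar R) (D : set R) :
  measurable D -> measurable_fun setT g -> (forall p, (0 <= g p)%E) ->
  measurable_fun setT (fun w => \int[mu]_(s in D) g (w, s))%E.
Proof.
move=> mD mg g0.
have := @measurable_fun_fubini_tonelli_F _ _ W _ R mu (g \_ (setT `*` D)).
rewrite (_ : fubini_F _ _ = (fun w => \int[mu]_(s in D) g (w, s))%E).
  apply=> [|p]; last by rewrite /patch; case: ifP.
  apply/(measurable_restrictT g); first exact: measurableX.
  exact: measurable_funTS.
apply/funext => w; rewrite /fubini_F [RHS]integral_mkcond.
apply: eq_integral => s _; rewrite /patch.
by congr (if _ then _ else _); apply/idP/idP; rewrite !inE => // -[].
Qed.

(** The integrals of the positive and negative parts are measurable by Tonelli, and [fine] is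
    measurable, so parameters with a divergent integral are covered too. *)
Lemma measurable_param_Rintegral (g : W * R -> R) (D : set R) :
  measurable D -> measurable_fun setT g ->
  measurable_fun setT (fun w => \int[mu]_(s in D) g (w, s)).
Proof.
move=> mD mg; apply: measurableT_comp; first exact: fine_measurable.
under eq_fun => w do rewrite integralE.
have mg' : measurable_fun setT (EFin \o g) by exact/measurable_EFinP.
have mp := measurable_param_integral mD (measurable_funepos mg') (fun p => funepos_ge0 _ p).
have mn := measurable_param_integral mD (measurable_funeneg mg') (fun p => funeneg_ge0 _ p).
apply: emeasurable_funB.
  by apply: eq_measurable_fun mp => w _; apply: eq_integral => s _; rewrite !funeposE.
by apply: eq_measurable_fun mn => w _; apply: eq_integral => s _; rewrite !funenegE.
Qed.

End ParametricIntegral.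

Section PathIntegral.
Context {R : realType} (U : normedModType R) (T : R) (T0 : 0 < T).
Local Notation mu := (@lebesgue_measure R).
Variable (g : R -> dual U).
Hypotheses (mg : measurable_fun `[0, T] (g : R -> borelT (dual U)))
  (ig : (\int[mu]_(s in `[0%R, T]) (`|g s|)%:E < +oo)%E).

Lemma dual_path_measurable y : measurable_fun `[0, T] (fun s => g s y).
Proof.
apply: (measurableT_comp (f := (fun f => f y) : borelT (dual U) -> R)) mg.
apply: continuous_borel_measurable; exact: dual_eval_continuous.
Qed.

Lemma norm_path_measurable : measurable_fun `[0, T] (fun s => `|g s|).
Proof.
apply: (measurableT_comp (f := (fun f => `|f|) : borelT (dual U) -> R)) mg.
apply: continuous_borel_measurable; exact: norm_continuous.
Qed.

Lemma norm_path_integrable : mu.-integrable `[0, T] (EFin \o (fun s => `|g s|)).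
Proof.
apply/integrableP; split; first by apply/measurable_EFinP; exact: norm_path_measurable.
by under eq_integral => s _ do rewrite /= normr_id.
Qed.

Lemma dual_path_integrable y : mu.-integrable `[0, T] (EFin \o (fun s => g s y)).
Proof.
apply: (@le_integrable _ _ _ mu _ _ _ (EFin \o (fun s => `|y| * `|g s|))) => //.
- by apply/measurable_EFinP; exact: dual_path_measurable.
- move=> s _ /=; rewrite lee_fin normrM !normr_id mulrC; exact: dual_le.
- by apply: (eq_integrable _ _ _ _ (integrableZl _ `|y| norm_path_integrable)) => // s _;
    rewrite /= EFinM.
Qed.

Lemma subitv0 (t : time T) : `[0, \val t]%classic `<=` `[0, T]%classic.
Proof.
apply: subset_itvl; rewrite bnd_simp.
by have := valP t; rewrite inE /= in_itv /= => /andP[].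
Qed.

Lemma dual_path_sub_integrable y (t : time T) :
  mu.-integrable `[0, \val t] (EFin \o (fun s => g s y)).
Proof. by apply: integrableS (dual_path_integrable y) => //; exact: subitv0. Qed.

Lemma norm_path_sub_integrable (t : time T) :
  mu.-integrable `[0, \val t] (EFin \o (fun s => `|g s|)).
Proof. by apply: integrableS norm_path_integrable => //; exact: subitv0. Qed.

Lemma integral_clamp_continuous y :
  continuous (fun s => \int[mu]_(x in `[0, \val (clamp T0 s)]) g x y).
Proof.
have h := parameterized_integral_continuous (ltW T0) (dual_path_integrable y).
move/subspace_sigL_continuousP in h => s.
apply: (@continuous_comp _ _ _ (clamp T0)
  (sigL `[0, T] (fun x => parameterized_integral mu 0 x (fun x => g x y)))).
  exact: clamp_continuous.
exact: h.
Qed.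

Lemma continuous_rat_eq0 (f : R -> R) : continuous f ->
  (forall q : rat, f (ratr q) = 0) -> forall s, f s = 0.
Proof.
move=> cf f0 s; apply/eqP; apply: contrapT => fs.
have oN : open (f @^-1` [set~ (0 : R)]).
  by move/continuousP: cf; apply; apply: closed_openC; exact: closed_eq.
have N0 : f @^-1` [set~ (0 : R)] !=set0 by exists s => /= /eqP.
have [x [/= nx [q _ qx]]] := dense_rat N0 oN.
by apply: nx; rewrite -qx.
Qed.

(** Both terms are continuous in time, which gives all [t] from rational times. Passing from [d n]
    to [y] changes the sum by at most [(|w t| + M) |y - d n|], with [M] the integral of [|g|] over
    [0,t]. *)
Lemma path_integral_eq0 (w : time T -> dual U) (d : nat -> U) : continuous w ->
  (forall x e, 0 < e -> exists n, `|x - d n| < e) ->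
  (forall (q : rat) n, w (clamp T0 (ratr q)) (d n) +
    \int[mu]_(s in `[0, \val (clamp T0 (ratr q))]) g s (d n) = 0) ->
  forall t y, w t y + \int[mu]_(s in `[0, \val t]) g s y = 0.
Proof.
move=> cw dd w0 t y.
have wd n : w t (d n) + \int[mu]_(s in `[0, \val t]) g s (d n) = 0.
  rewrite -(clampK T0 t); move: (\val t).
  apply: continuous_rat_eq0; last by move=> q; exact: w0.
  move=> s; apply: cvgD; last exact: integral_clamp_continuous.
  apply: (@continuous_comp _ _ _ (fun s => w (clamp T0 s)) (fun f : dual U => f (d n) : R)).
    apply: (@continuous_comp _ _ _ (clamp T0) w); first exact: clamp_continuous.
    exact: cw.
  exact: dual_eval_continuous.
apply/eqP; rewrite -normr_le0; apply/ler_addgt0Pr => e e0; rewrite add0r.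
set M := \int[mu]_(s in `[0, \val t]) `|g s|.
have M0 : 0 <= M by apply: Rintegral_ge0.
have k0 : 0 < `|w t| + M + 1 by rewrite ltr_wpDl// addr_ge0.
have [n yn] := dd y _ (divr_gt0 e0 k0).
have -> : w t y + \int[mu]_(s in `[0, \val t]) g s y =
    w t (y - d n) + \int[mu]_(s in `[0, \val t]) g s (y - d n).
  have subE (a b : R) : b = 0 -> a = a - b by move=> ->; rewrite subr0.
  rewrite [LHS](@subE _ _ (wd n)) opprD addrACA linearB; congr (_ + _).
  have -> : (fun s => g s (y - d n)) = (fun s => g s y - g s (d n)).
    by apply/funext => s; rewrite linearB.
  by rewrite RintegralB//; exact: dual_path_sub_integrable.
apply: le_trans (ler_normD _ _) _.
apply: (@le_trans _ _ ((`|w t| + M + 1) * `|y - d n|)); last first.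
  by rewrite mulrC -ler_pdivlMr// ltW.
rewrite !mulrDl mul1r -[leLHS]addr0 lerD// lerD//; first exact: dual_le.
apply: le_trans (le_normr_Rintegral _ _) _ => //; first exact: dual_path_sub_integrable.
rewrite /M -RintegralZr//; last exact: norm_path_sub_integrable.
apply: le_Rintegral => //.
- have := dual_path_sub_integrable (y - d n) t; move/integrable_abse.
  by apply: eq_integrable.
- by apply: (eq_integrable _ _ _ _ (integrableZr _ `|y - d n| (norm_path_sub_integrable t)))
    => // s _; rewrite /= EFinM.
- move=> s _; exact: dual_le.
Qed.

End PathIntegral.

Section Graph.
Context {R : realType} {U H : completeNormedModType R}.
Variables (ip : {dot H for idfun}) (iota : {linear U -> H}).
Hypotheses (UH : embedding_triple ip iota) (sepU : separable U).
Variables (T r : R) (T0 : 0 < T) (r1 : 1 < r).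
Variables (A : U -> dual U) (mA : borel_fun A).
Local Notation mu := (@lebesgue_measure R).
Local Notation X1 := (X1 ip iota T r1).
Local Notation CTU := (CT T (dual U)).
Implicit Types (w v : CTU) (u : X1).

Definition unembed : dual U -> U := embed_inv (embed UH).

Lemma unembed_borel : borel_fun unembed.
Proof.
apply: embed_inv_borel => //; first exact: embed_sym.
  exact: embed_continuous.
exact: embed_dense.
Qed.

Lemma dualU_separable : separable (dual U).
Proof.
by apply: (dual_separable (J := embed UH)) => //; [exact: embed_continuous|exact: embed_dense].
Qed.

Lemma represents_unembed x f : represents ip iota (iota x) f -> unembed f = x.
Proof.
move=> /(representsE UH) ->; apply: embedK => //; first exact: embed_sym.
  exact: embed_continuous.
exact: embed_dense.
Qed.

(* A(u(s)) as a Borel functional of the path in C[0,T;U']. *)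
Definition drift w (s : R) : dual U := A (unembed (w (clamp T0 s))).

Lemma drift_measurable : measurable_fun setT
  ((fun p => drift p.1 p.2) : (borelT CTU * R)%type -> borelT (dual U)).
Proof.
have mE := path_eval_measurable T0 dualU_separable.
have mU := borel_measurable_fun unembed_borel.
have mA' := borel_measurable_fun mA.
exact: (measurableT_comp mA' (measurableT_comp mU mE)).
Qed.

Lemma drift_eval_measurable y : measurable_fun setT
  ((fun p => drift p.1 p.2 y) : (borelT CTU * R)%type -> R).
Proof.
apply: (measurableT_comp (f := (fun f => f y) : borelT (dual U) -> R)) drift_measurable.
apply: continuous_borel_measurable; exact: dual_eval_continuous.
Qed.

Lemma drift_norm_measurable : measurable_fun setT
  ((fun p => `|drift p.1 p.2|) : (borelT CTU * R)%type -> R).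
Proof.
apply: (measurableT_comp (f := (fun f => `|f|) : borelT (dual U) -> R)) drift_measurable.
apply: continuous_borel_measurable; exact: norm_continuous.
Qed.

Lemma lebesgue_aeS (P Q : R -> Prop) : (forall s, P s -> Q s) ->
  {ae mu, forall s, P s} -> {ae mu, forall s, Q s}.
Proof. by move=> PQ; apply: negligibleS => s /= nQ Ps; apply: nQ; exact: PQ. Qed.

Lemma X1_Lr_measurable u :
  measurable_fun `[0, T] ((X1_Lr u : Lp U T (ltW r1)) : R -> borelT U).
Proof.
have := Lp_funP (X1_Lr u : Lp U T (ltW r1)); rewrite inE => -[su _].
exact: strongly_measurable_fun.
Qed.

Lemma A_X1_Lr_measurable u :
  measurable_fun `[0, T] ((fun s => A (X1_Lr u s)) : R -> borelT (dual U)).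
Proof.
exact: (measurableT_comp (borel_measurable_fun mA) (X1_Lr_measurable u)).
Qed.

Lemma drift_X1_ae u : {ae mu, forall s, `[0, T]%classic s -> drift (X1_C u) s = A (X1_Lr u s)}.
Proof.
have := svalP (cid (X1_Lr_subproof u)); apply: lebesgue_aeS => s h sT.
have sT' : s \in `[0, T]%classic by rewrite inE.
rewrite /drift (clamp_id T0 sT'); congr A; apply: represents_unembed; exact: h.
Qed.

Lemma drift_path_measurable w :
  measurable_fun setT (drift w : R -> borelT (dual U)).
Proof.
have m : measurable_fun setT (fun s : R => (w, s) : (borelT CTU * R)%type).
  exact: measurable_pair1.
exact: (measurableT_comp drift_measurable m).
Qed.

(** This expresses the drift through the path in C[0,T;U'] alone, on which it depends measurably;
    the chosen representative in L^r disappears. *)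
Lemma integral_drift u (t : time T) y :
  \int[mu]_(s in `[0, \val t]) A (X1_Lr u s) y = \int[mu]_(s in `[0, \val t]) drift (X1_C u) s y.
Proof.
congr fine; apply: ae_eq_integral => //.
- apply/measurable_EFinP; apply: measurable_funS (dual_path_measurable (A_X1_Lr_measurable u) y) => //.
  exact: subitv0.
- apply/measurable_EFinP; apply: measurable_funS (dual_path_measurable
    (measurable_funTS (drift_path_measurable (X1_C u))) y) => //.
  exact: subitv0.
- have := drift_X1_ae u; apply: lebesgue_aeS => s h /(@subitv0 _ _ t) sT.
  by rewrite h.
Qed.

Lemma in_L1_drift u :
  in_L1 A u <-> (\int[mu]_(s in `[0%R, T]) (`|drift (X1_C u) s|)%:E < +oo)%E.
Proof.
have E : (\int[mu]_(s in `[0%R, T]) (`|A (X1_Lr u s)|)%:E =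
    \int[mu]_(s in `[0%R, T]) (`|drift (X1_C u) s|)%:E)%E.
  apply: ae_eq_integral => //.
  - by apply/measurable_EFinP; exact: norm_path_measurable (A_X1_Lr_measurable u).
  - apply/measurable_EFinP; exact: norm_path_measurable
      (measurable_funTS (drift_path_measurable (X1_C u))).
  - by have := drift_X1_ae u; apply: lebesgue_aeS => s h sT; rewrite h.
rewrite -E /in_L1 /in_Lp; under eq_integral => s _ do rewrite powRr1//.
split=> [[]//|h]; split=> //.
by apply/strongly_measurableP => //; [exact: dualU_separable|exact: A_X1_Lr_measurable].
Qed.

Lemma in_L1_integrable u : in_L1 A u ->
  (\int[mu]_(s in `[0%R, T]) (`|A (X1_Lr u s)|)%:E < +oo)%E.
Proof.
by rewrite /in_L1 /in_Lp; under eq_integral => s _ do rewrite powRr1//; case.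
Qed.

Variable d : nat -> U.
Hypothesis dd : forall x e, 0 < e -> exists n, `|x - d n| < e.

(** An enumeration of the clamped rationals; codes that decode to no rational give time 0. *)
Definition rat_time (k : nat) : time T := clamp T0 (ratr (odflt 0 (unpickle k) : rat)).

(** The set G of the overview. Rational times and the test vectors [d n] keep the intersection
    countable; [path_integral_eq0] recovers all times and vectors for differences. The first
    component is any path in C[0,T;U'], not only one coming from [X1]. *)
Definition equation_graph : set (CTU * CTU) :=
  [set p | (\int[mu]_(s in `[0%R, T]) (`|drift p.1 s|)%:E < +oo)%E] `&`
  \bigcap_k \bigcap_n [set p : (CTU * CTU)%type | p.1 (rat_time k) (d n) - (p.2 (rat_time k) (d n) -
     \int[mu]_(s in `[0, \val (rat_time k)]) drift p.1 s (d n)) = 0].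

Lemma equation_graph_borel : borel equation_graph.
Proof.
have mfst : measurable_fun setT (fst : borelT (CTU * CTU)%type -> borelT CTU).
  by apply: borel_measurable_fun; apply: continuous_borel_fun => p; exact: cvg_fst.
have msnd : measurable_fun setT (snd : borelT (CTU * CTU)%type -> borelT CTU).
  by apply: borel_measurable_fun; apply: continuous_borel_fun => p; exact: cvg_snd.
have mev t y : measurable_fun setT ((fun w => w t y) : borelT CTU -> R).
  apply: continuous_borel_measurable => w.
  apply: (@continuous_comp _ _ _ (fun w : CTU => w t) (fun f : dual U => f y : R)).
    exact: CT_eval_continuous.
  exact: dual_eval_continuous.
apply: borelI.
  have m := @measurable_param_integral R _ (borelT CTU)
    (fun p => (`|drift p.1 p.2|)%:E) `[0, T]%classic.
  have {}m : measurable_fun setT (fun w : borelT CTU =>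
      \int[mu]_(s in `[0%R, T]) (`|drift w s|)%:E)%E.
    by apply: m => //; apply/measurable_EFinP; exact: drift_norm_measurable.
  have := emeasurable_fun_infty_o measurableT (measurableT_comp m mfst) +oo%E.
  by rewrite setTI.
apply: borel_bigcap => k; apply: borel_bigcap => n.
have m : measurable_fun setT ((fun p : (CTU * CTU)%type =>
    p.1 (rat_time k) (d n) - (p.2 (rat_time k) (d n) -
     \int[mu]_(s in `[0, \val (rat_time k)]) drift p.1 s (d n))) : borelT (CTU * CTU)%type -> R).
  apply: measurable_funB; first exact: measurableT_comp (mev _ _) mfst.
  apply: measurable_funB; first exact: measurableT_comp (mev _ _) msnd.
  have mi := @measurable_param_Rintegral R _ (borelT CTU)
    (fun p => drift p.1 p.2 (d n)) `[0, \val (rat_time k)]%classic.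
  have {}mi := mi (measurable_itv _) (drift_eval_measurable (d n)).
  exact: (measurableT_comp mi mfst).
have := m measurableT [set 0] (measurable_set1 _).
by rewrite setTI.
Qed.

(** Subtracting the two equations cancels [v] and leaves the equation of Assumption (A) with
    [lam = 1]. *)
Lemma equation_graph_unique u1 u2 v : assumption_A ip iota T r1 A ->
  equation_graph (X1_C u1, v) -> equation_graph (X1_C u2, v) -> u1 = u2.
Proof.
move=> hA [i1 e1] [i2 e2].
have L1 : in_L1 A u1 by apply/in_L1_drift.
have L2 : in_L1 A u2 by apply/in_L1_drift.
apply: (hA 1) => // t y.
pose g s := A (X1_Lr u2 s) - A (X1_Lr u1 s).
have m1 := A_X1_Lr_measurable u1; have m2 := A_X1_Lr_measurable u2.
have mg : measurable_fun `[0, T] (g : R -> borelT (dual U)).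
  apply: strongly_measurable_fun => //.
  (* The difference is measurable because simple approximations of the two terms can be subtracted
     pointwise. *)
  have [s1 [ss1 c1]] := measurable_strongly (measurable_itv _) dualU_separable m1.
  have [s2 [ss2 c2]] := measurable_strongly (measurable_itv _) dualU_separable m2.
  exists (fun n s => s2 n s - s1 n s); split=> [n|s sT].
    exact: (simple_map2 (fun x y => x - y)).
  by apply: cvgB; [exact: c2|exact: c1].
have n1 := norm_path_integrable m1 (in_L1_integrable L1).
have n2 := norm_path_integrable m2 (in_L1_integrable L2).
have ig : (\int[mu]_(s in `[0%R, T]) (`|g s|)%:E < +oo)%E.
  apply: (@le_lt_trans _ _ (\int[mu]_(s in `[0%R, T])
     ((`|A (X1_Lr u2 s)|)%:E + (`|A (X1_Lr u1 s)|)%:E))%E).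
    apply: ge0_le_integral => //.
    - by apply/measurable_EFinP; exact: norm_path_measurable mg.
    - by apply: emeasurable_funD; apply/measurable_EFinP; exact: norm_path_measurable.
    - by move=> s _; rewrite -EFinD lee_fin; exact: ler_normB.
  rewrite ge0_integralD//.
  - by apply: lte_add_pinfty; exact: in_L1_integrable.
  - by apply/measurable_EFinP; exact: norm_path_measurable m2.
  - by apply/measurable_EFinP; exact: norm_path_measurable m1.
have -> : \int[mu]_(s in `[0, \val t]) (1 * (A (X1_Lr u2 s) - A (X1_Lr u1 s)) y) =
    \int[mu]_(s in `[0, \val t]) g s y.
  by apply: eq_Rintegral => s _; rewrite mul1r.
apply: (@path_integral_eq0 _ _ _ T0 g mg ig (fun t => X1_C u2 t - X1_C u1 t) d) => //.
  have c u : continuous (X1_C u : time T -> dual U) by exact: cts_fun.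
  by move=> s; exact: (cvgB (c u2 s) (c u1 s)).
move=> q n.
have gE : \int[mu]_(s in `[0, \val (clamp T0 (ratr q))]) g s (d n) =
    \int[mu]_(s in `[0, \val (clamp T0 (ratr q))]) A (X1_Lr u2 s) (d n) -
    \int[mu]_(s in `[0, \val (clamp T0 (ratr q))]) A (X1_Lr u1 s) (d n).
  by rewrite -RintegralB//; apply: dual_path_sub_integrable => //; exact: in_L1_integrable.
rewrite gE !integral_drift.
have := e1 (pickle q) I n I; have := e2 (pickle q) I n I.
rewrite /rat_time pickleK /=.
rewrite -[(_ - _) (d n)]/(X1_C u2 _ (d n) - X1_C u1 _ (d n)).
lra.
Qed.

End Graph.

(** * Comparison of the laws *)

Section PathSpace.
Context {R : realType} (T : R) (E : normedModType R).
Local Notation CTE := (CT T E).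

(** A closed set is the intersection of its uniform 1/(n+1)-neighbourhoods, made open by taking
    interiors. This supplies the hypothesis of the regularity results. *)
Lemma CT_pair_closed_Gdelta (C : set (CTE * CTE)) : closed C ->
  exists2 W : nat -> set (CTE * CTE), (forall n, open (W n)) & C = \bigcap_n W n.
Proof.
move=> cC; pose B (e : R) (p : CTE * CTE) := [set q : CTE * CTE |
  (forall t, `|p.1 t - q.1 t| < e) /\ (forall t, `|p.2 t - q.2 t| < e)].
have nB e p : 0 < e -> nbhs p (B e p).
  case: p => w v e0; exists ([set w' : CTE | forall t, `|w t - w' t| < e],
    [set v' : CTE | forall t, `|v t - v' t| < e]); last by case.
  by split; apply/CT_nbhsP; exists e.
exists (fun n => \bigcup_(p in C) interior (B n.+1%:R^-1 p)).
  by move=> n; apply: bigcup_open => p _; exact: open_interior.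
apply/seteqP; split=> [p Cp n _|q CW].
  by exists p => //; apply: nB; rewrite invr_gt0.
apply: cC => N [[N1 N2] /= [/CT_nbhsP[e1 e10 h1] /CT_nbhsP[e2 e20 h2]] NN].
have e0 : 0 < Num.min e1 e2 by rewrite lt_min e10.
have [n _ /(_ n (leqnn n))/=] := near_infty_natSinv_lt (PosNum e0).
rewrite lt_min => /andP[ne1 ne2].
have [p Cp /interior_subset[/= p1 p2]] := CW n I.
exists p; split=> //; rewrite [p]surjective_pairing; apply: NN; split=> /=.
  by apply: h1 => t; rewrite distrC; exact: lt_trans (p1 t) ne1.
by apply: h2 => t; rewrite distrC; exact: lt_trans (p2 t) ne2.
Qed.

End PathSpace.

Section X1Embedding.
Context {R : realType} {U H : completeNormedModType R}.
Variables (ip : {dot H for idfun}) (iota : {linear U -> H}) (T r : R) (r1 : 1 < r).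
Local Notation X1 := (X1 ip iota T r1).

Lemma X1_C_inj : injective (@X1_C R U H ip iota T r r1).
Proof. by move=> [w hw] [v hv] /= wv; subst v; congr MkX1; exact: Prop_irrelevance. Qed.

Lemma X1_C_continuous : continuous (@X1_C R U H ip iota T r r1 : X1 -> CT T (dual U)).
Proof.
move=> u N Nu.
have h : nbhs u --> u by exact: cvg_id.
have /cvg_sup/(_ true) h' := h.
apply: h'; exact: (@initial_continuous X1 _ (@X1_C R U H ip iota T r r1) u N Nu).
Qed.

End X1Embedding.

Lemma ae_subset_measure (R : realType) d (Om : measurableType d)
    (P : probability Om R) (A B : set Om) :
  measurable A -> measurable B -> {ae P, forall om, A om -> B om} -> (P A <= P B)%E.
Proof.
move=> mA mB [N [mN N0 AB]]; apply: (@le_trans _ _ (P (B `|` N))).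
  apply: le_measure; rewrite ?inE//; first exact: measurableU.
  move=> om Aom; have [Bom|nB] := pselect (B om); [by left|right].
  by apply: AB => /= /(_ Aom).
have := @measureU2 _ _ _ P _ _ mB mN; rewrite [X in (_ + X)%E](_ : _ = 0%E) ?adde0//.
Qed.

Section Comparison.
Context {R : realType} {U H : completeNormedModType R}.
Variables (ip : {dot H for idfun}) (iota : {linear U -> H}).
Hypotheses (UH : embedding_triple ip iota) (sepU : separable U).
Variables (T r : R) (T0 : 0 < T) (r1 : 1 < r).
Variables (A : U -> dual U) (mA : borel_fun A).
Local Notation X1 := (X1 ip iota T r1).
Local Notation CTU := (CT T (dual U)).

(** The null set in [solution_eq] depends on [t] and [v]; only countably many such pairs enter
    [equation_graph]. *)
Lemma solution_equation_graph (d : nat -> U) dO (Om : measurableType dO)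
    (P : probability Om R) (u : Om -> X1) (V : Om -> CTU) :
  solution A P u V ->
  {ae P, forall om, equation_graph UH T0 A d (X1_C (u om), V om)}.
Proof.
move=> sol.
have EQ : {ae P, forall om, forall k n, X1_C (u om) (rat_time T0 k) (d n) =
    V om (rat_time T0 k) (d n) -
    \int[lebesgue_measure]_(s in `[0, \val (rat_time T0 k)]) A (X1_Lr (u om) s) (d n)}.
  by apply: ae_foralln => k; apply: ae_foralln => n; exact: (solution_eq sol).
have L1 := solution_L1 sol.
apply: filterS2 L1 EQ => om L1 EQ; split=> /=.
  by apply/in_L1_drift.
move=> k _ n _ /=; rewrite EQ integral_drift//; exact: subrr.
Qed.

Lemma law_pair_le d0 d1 (Om0 : measurableType d0) (P0 : probability Om0 R)
    (Om1 : measurableType d1) (P1 : probability Om1 R)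
    (u0 : Om0 -> X1) (V0 : Om0 -> CTU) (u1 : Om1 -> X1) (V1 : Om1 -> CTU) :
  assumption_A ip iota T r1 A -> solution A P0 u0 V0 -> solution A P1 u1 V1 ->
  (forall B, borel B -> law P0 V0 B = law P1 V1 B) ->
  forall B, borel B ->
    (law P0 (fun om => (u0 om, V0 om)) B <= law P1 (fun om => (u1 om, V1 om)) B)%E.
Proof.
move=> hA sol0 sol1 lawV B bB.
have [d dd] := separable_seq sepU.
pose G := equation_graph UH T0 A d.
have bG : borel G by exact: equation_graph_borel.
pose h : X1 -> CTU := @X1_C R U H ip iota T r r1.
have ch : continuous h by exact: X1_C_continuous.
have ih : injective h by exact: X1_C_inj.
have [S [K [cK SK]] PS] := solution_sigma_compact sol0.
have chK n : compact (h @` K n).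
  by apply: continuous_compact => //; apply: continuous_subspaceT.
have clK n : closed (h @` K n) by apply: compact_closed => //; exact: CT_hausdorff.
have rv0 : Defs.random_variable (fun om => (h (u0 om), V0 om)).
  have bj : borel_fun (fun p : X1 * CTU => (h p.1, p.2)).
    apply: continuous_borel_fun => -[u v].
    have c1 : h p.1 @[p --> (u, v)] --> h u.
      by apply: (@cvg_comp _ _ _ fst h _ (nbhs u)); [exact: cvg_fst|exact: ch].
    exact: (cvg_pair c1 cvg_snd).
  by move=> C bC; exact: (solution_rv sol0 (bj _ bC)).
have bsnd : borel_fun (snd : X1 * CTU -> CTU).
  by apply: continuous_borel_fun => p; exact: cvg_snd.
have rV0 C : borel C -> measurable (V0 @^-1` C).
  by move=> bC; exact: (solution_rv sol0 (bsnd _ bC)).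
have rV1 C : borel C -> measurable (V1 @^-1` C).
  by move=> bC; exact: (solution_rv sol1 (bsnd _ bC)).
have /choice[B' BB'] : forall n, exists B', borel B' /\
    forall x y, K n x -> B (x, y) <-> B' (h x, y).
  move=> n; have [B' bB' BB'] :=
    borel_compact_transfer (@CT_hausdorff _ _ _) ch ih (cK n) bB.
  by exists B'.
(* The part of [B] over [K n] that satisfies the equation, transported to pairs of paths. *)
pose C n : set (CTU * CTU) := G `&` B' n `&` [set p | (h @` K n) p.1].
have bC n : borel (C n).
  apply: borelI; first by apply: borelI => //; case: (BB' n).
  apply: closed_borel; apply: (preimage_closed (f := fst) (D := h @` K n)) => //.
  by move=> p _; exact: cvg_fst.
have /choice[F FC] : forall n, exists F : nat -> set (CTU * CTU),
    [/\ forall m, closed (F m), \bigcup_m F m `<=` C n &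
      P0 ((fun om => (h (u0 om), V0 om)) @^-1` (C n `\` \bigcup_m F m)) = 0%E].
  by move=> n; apply: (borel_inner_Fsigma P0 rv0) => //; exact: CT_pair_closed_Gdelta.
have cF n m : closed (F n m) by case: (FC n).
(* Each [F n m] is closed and lies over the compact set [h (K n)], so its projection is closed and
   [D] is Borel. *)
pose D := \bigcup_n \bigcup_m (snd @` F n m).
have bD : borel D.
  apply: borel_bigcup => n; apply: borel_bigcup => m; apply: closed_borel.
  apply: (compact_closed_image_snd (chK n)) => // p Fp.
  by case: (FC n) => _ FCn _; have [|_] := FCn p; [exists m|].
(* Almost surely [u0] lies in some [K n]; if the pair is also in [B], its image lies in [C n], hence
   up to a null set in some [F n m], and [V0] lies in [D]. *)
apply: (@le_trans _ _ (P0 (V0 @^-1` D))).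
  apply: ae_subset_measure; [exact: (solution_rv sol0)|exact: rV0|].
  have aeF : {ae P0, forall om, forall n,
      C n (h (u0 om), V0 om) -> (\bigcup_m F n m) (h (u0 om), V0 om)}.
    apply: ae_foralln => n; case: (FC n) => _ _ F0.
    exists ((fun om => (h (u0 om), V0 om)) @^-1` (C n `\` \bigcup_m F n m)); split=> //.
      apply: rv0; apply: borelI => //; apply: borelC; apply: borel_bigcup => m.
      exact: closed_borel.
    by move=> om /= /not_implyP.
  have aeS : {ae P0, forall om, S (u0 om)}.
    have mS : measurable (u0 @^-1` S).
      (* Injectivity of [h] lets membership in [K n] be read off from the closed set [h (K n)]. *)
      rewrite (_ : _ @^-1` _ = (fun om => (h (u0 om), V0 om)) @^-1`
          (\bigcup_n [set p | (h @` K n) p.1])).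
        apply: rv0; apply: borel_bigcup => n; apply: closed_borel.
        apply: (preimage_closed (f := fst) (D := h @` K n)) => //.
        by move=> p _; exact: cvg_fst.
      rewrite SK; apply/seteqP; split=> om [n _ Kn]; exists n => //; first by exists (u0 om).
      by case: Kn => x Kx /ih <-.
    exists (~` (u0 @^-1` S)); split=> //; first exact: measurableC.
    by rewrite probability_setC// PS subee.
  apply: filterS3 aeF aeS (solution_equation_graph d sol0) => om Fom Som Gom Bom.
  move: Som; rewrite SK => -[n _ Kn].
  have [|m _ Fm] := Fom n.
    split; last by exists (u0 om).
    by split=> //; case: (BB' n) => _ /(_ _ (V0 om) Kn) [+ _]; exact.
  by exists n => //; exists m => //; exists (h (u0 om), V0 om).
rewrite -[P0 _]/(law P0 V0 D) lawV//.
apply: ae_subset_measure; [exact: rV1|exact: (solution_rv sol1)|].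
(* If [V1] lies in [D], some [k] in [K n] solves the equation with [V1] and has [(k, V1)] in [B]. As
   [u1] solves it too, uniqueness gives [k = u1]. *)
apply: filterS (solution_equation_graph d sol1) => om Gom [n _ [m _ [[w v] Fwv /= vV]]].
rewrite vV in Fwv.
have [_ FCn _] := FC n.
have [|[Gw Bw] /= [k Kk kw]] := FCn (w, V1 om); first by exists m.
move: Gw Bw; rewrite -kw => Gw Bw.
have ku : k = u1 om by exact: (equation_graph_unique sepU mA dd hA Gw Gom).
rewrite -ku; case: (BB' n) => _ /(_ _ (V1 om) Kk) [_]; exact.
Qed.

End Comparison.

Theorem theorem1p17 (R : realType) (U H : completeNormedModType R)
    (ip : {dot H for idfun}) (iota : {linear U -> H})
    (UH : embedding_triple ip iota) (sepU : separable U)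
    (T r : R) (T0 : 0 < T) (r1 : 1 < r)
    (A : U -> dual U) (mA : borel_fun A)
    (hA : assumption_A ip iota T r1 A)
    (d0 d1 : measure_display)
    (Om0 : measurableType d0) (P0 : probability Om0 R)
    (Om1 : measurableType d1) (P1 : probability Om1 R)
    (u0 : Om0 -> X1 ip iota T r1) (V0 : Om0 -> CT T (dual U))
    (u1 : Om1 -> X1 ip iota T r1) (V1 : Om1 -> CT T (dual U))
    (sol0 : solution A P0 u0 V0) (sol1 : solution A P1 u1 V1)
    (lawV : forall B, borel B -> law P0 V0 B = law P1 V1 B) :
  forall B, borel B ->
    law P0 (fun om => (u0 om, V0 om)) B = law P1 (fun om => (u1 om, V1 om)) B.
Proof.
move=> B bB; apply/eqP; rewrite eq_le.
rewrite (law_pair_le UH sepU T0 mA hA sol0 sol1 lawV bB)/=.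
by apply: (law_pair_le UH sepU T0 mA hA sol1 sol0 _ bB) => C bC; rewrite lawV.
Qed.
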